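(* Let $n\ge 1$, let $\gamma_n=(1,2,\ldots,n)\in S_n$ and let $G_n=\langle\gamma_n\rangle\le S_n$. Then for every partition $\lambda$ of $n$ and every $j\in\{0,1,\dots,n-1\}$, the group $G_n$ acts on $S_{\lambda,j}$ by conjugation, and the triple $(G_n,S_{\lambda,j},a_{\lambda,j}(q))$ exhibits the cyclic sieving phenomenon. In other words, if $\tau\in G_n$ has order $d$ and $\omega_d$ is any primitive complex $d$-th root of unity, then \[ a_{\lambda,j}(\omega_d)=|C_{S_n}(\tau)\cap S_{\lambda,j}|, \] where $C_{S_n}(\tau)$ is the centralizer of $\tau$ in $S_n$.
   Context: Permutations $\sigma\in S_n$ act on the right on $[n]=\{1,\dots,n\}$, writing $i\sigma$. The excedance set is ${\rm Exc}(\sigma)=\{i\in[n-1]: i\sigma>i\}$, ${\rm exc}(\sigma)=|{\rm Exc}(\sigma)|$; the descent set is ${\rm Des}(\sigma)=\{i\in[n-1]: i\sigma>(i+1)\sigma\}$ and ${\rm maj}(\sigma)=\sum_{i\in{\rm Des}(\sigma)} i$. For a partition $\lambda$ of $n$, $S_{\lambda,j}$ is the set of permutations in $S_n$ of cycle type $\lambda$ with exactly $j$ excedances, and $a_{\lambda,j}(q)=\sum_{\sigma\in S_{\lambda,j}} q^{{\rm maj}(\sigma)-{\rm exc}(\sigma)}$. A triple $(G,X,f(q))$, with $G$ a finite cyclic group acting on a finite set $X$ and $f(q)$ a polynomial, exhibits the cyclic sieving phenomenon if for every $g\in G$, $f(\omega_{|g|})$ equals the number of points of $X$ fixed by $g$,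 where $|g|$ is the order of $g$ and $\omega_{|g|}$ is a primitive $|g|$-th root of unity. *)

(* Defs.v *)
From HB Require Import structures.
From mathcomp Require Import all_boot all_order all_algebra all_fingroup.
From mathcomp Require Import all_solvable.
From mathcomp Require Import reals complex.

Set Implicit Arguments.
Unset Strict Implicit.
Unset Printing Implicit Defensive.

Import GRing.Theory Num.Theory.

(* [n] = {1, ..., n} is rendered as 'I_n, so that i : 'I_n stands for i.+1.
   The product of 'S_n is composition from left to right, i.e. permutations
   act on the right, i sigma being sigma i. *)

Section PermutationStatistics.

Variable n : nat.
Implicit Types s : 'S_n.

(* ordS i = i + 1 mod n: this is the n-cycle (1, 2, ..., n). *)
Definition gamma : 'S_n := perm (@ordS_inj n).

Definition Exc s : {set 'I_n} := [set i : 'I_n | (i.+1 < n) && (i < s i)].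

Definition exc s : nat := #|Exc s|.

(* Under the guard i.+1 < n, ordS i is the genuine successor of i. *)
Definition Des s : {set 'I_n} :=
  [set i : 'I_n | (i.+1 < n) && (s (ordS i) < s i)].

Definition maj s : nat := \sum_(i in Des s) i.+1.

(* All the cycles of s are counted, including those of length 1. *)
Definition cycle_type s : seq nat :=
  sort geq [seq #|C| | C : {set 'I_n} <- enum (porbits s)].

Definition Sperm (lambda : seq nat) (j : nat) : {set 'S_n} :=
  [set s : 'S_n | (cycle_type s == lambda) && (exc s == j)].

(* This makes the truncated subtraction in apoly below an exact one. *)
Lemma exc_le_maj s : exc s <= maj s.
Proof.
have [E0|[i0 i0E]] := set_0Vmem (Exc s); first by rewrite /exc E0 cards0.
case: (arg_maxnP (fun i : 'I_n => i : nat) i0E) => m mE mmax.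
have [d dD led] : exists2 d, d \in Des s & m <= d.
  have : m \in Exc s := mE; rewrite inE => /andP[lt_m lt_ms].
  have [/existsP[d /andP[dD led]]|/existsPn noD] :=
    boolP [exists d, (d \in Des s) && (m <= d)]; first by exists d.
  have H : forall k (lt_k : m + k < n), s m + k <= s (Ordinal lt_k).
    elim=> [|k IHk] lt_k.
      by rewrite addn0; have -> : Ordinal lt_k = m by apply: val_inj; rewrite /= addn0.
    have lt_k' : m + k < n by rewrite (leq_trans _ lt_k) // addnS.
    have eS : ordS (Ordinal lt_k') = Ordinal lt_k.
      by apply: val_inj; rewrite /= modn_small -addnS.
    have := noD (Ordinal lt_k'); rewrite inE /= leq_addr andbT eS -addnS lt_k /=.
    rewrite -leqNgt leq_eqVlt => /orP[/eqP/val_inj/perm_inj/(congr1 val)/=/eqP|].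
      by rewrite eqn_add2l eqn_leq ltnn andbF.
    by apply: leq_trans; rewrite addnS ltnS.
  have n_gt0 : 0 < n by apply: leq_trans lt_m.
  have lemn : m <= n.-1 by rewrite -ltnS prednK // ltnW.
  have lt_l : m + (n.-1 - m) < n by rewrite subnKC // prednK.
  have := leq_ltn_trans (H _ lt_l) (ltn_ord _).
  have -> : (s m + (n.-1 - m) < n) = (s m + (n.-1 - m) <= m + (n.-1 - m)).
    by rewrite (subnKC lemn) -[RHS]ltnS prednK.
  by rewrite leq_add2r leqNgt lt_ms.
have -> : maj s = d.+1 + \sum_(i in Des s | i != d) i.+1 by rewrite /maj (bigD1 d).
apply: leq_trans (leq_addr _ _).
have <- : #|[set widen_ord (ltn_ord d) i | i : 'I_d.+1]| = d.+1.
  rewrite card_imset ?card_ord // => i k /(congr1 val) eik.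
  exact: val_inj.
apply/subset_leq_card/subsetP => i iE.
have lt_id : i < d.+1 by rewrite ltnS (leq_trans (mmax _ iE) led).
by apply/imsetP; exists (Ordinal lt_id) => //; apply: val_inj.
Qed.

End PermutationStatistics.

Arguments gamma n : clear implicits.
Arguments Sperm n lambda j : clear implicits.

Definition is_partition (n : nat) (lambda : seq nat) : bool :=
  [&& sorted geq lambda, 0 \notin lambda & sumn lambda == n].

Local Open Scope ring_scope.

Definition apoly (n : nat) (lambda : seq nat) (j : nat) : {poly int} :=
  \sum_(s in Sperm n lambda j) 'X^(maj s - exc s).

Definition eval_at (K : nzRingType) (f : {poly int}) (w : K) : K :=
  (map_poly intr f).[w].

Definition cyclic_sieving (R : realType) (gT : finGroupType) (G : {group gT})
    (T : finType) (to : {action gT &-> T}) (X : {set T}) (f : {poly int}) :=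
  [/\ cyclic G, [acts G, on X | to]
    & forall (g : gT) (w : R[i]), g \in G -> #[g]%g.-primitive_root w ->
        eval_at f w = #|('Fix_(X | to)[g])%g|%:R].

(* Main.v *)
Require Import Defs.
From HB Require Import structures.
From mathcomp Require Import all_boot all_order all_algebra all_fingroup.
From mathcomp Require Import all_solvable.
From mathcomp Require Import reals complex.
From mathcomp Require Import zify ring.

(** Following Gessel-Reutenauer and Shareshian-Wachs, replace every letter of the cycle form
    of [s] by the entry of a weakly decreasing sequence [f] that drops strictly where [s]
    requires it, and colour it red at the excedances: this turns the pairs [(s, f)] into
    multisets of primitive bicolored necklaces, with cycle lengths becoming necklace lengths
    and excedances red letters.  Summing [w ^ (\sum_i f i)] over the [f] with [d * M] letters
    gives [w ^ (maj s - exc s)] times a binomial coefficient monic in [M].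

    A bicolored necklace is a closed walk on the circle Z/(d M) with steps in [0, d M], and
    its number of red letters is its winding number; hence the rotation by [M] acts on
    multisets of necklaces and preserves lengths and red letters.  The sum of
    [w ^ (sum of letters)] over closed walks is a product of geometric sums, and counts the
    walks having the symmetry of an element of order [d]; Newton's recursion lifts this to
    multisets: the weighted count of the pairs [(s, f)] is the number of rotation-invariant
    multisets.  Inclusion-exclusion over the set of letters used, modulo rotation, kills the
    binomial coefficients on one side, and on the other side leaves the multisets in which
    each of n letters occurs once, i.e. the permutations commuting with the rotation. *)

Set Implicit Arguments.
Unset Strict Implicit.
Unset Printing Implicit Defensive.

Import GRing.Theory Num.Theory.

(** * Inclusion-exclusion and elementary symmetric functions at roots of unity *)

Section InclusionExclusion.

Local Open Scope ring_scope.

(** For one alphabet size the contribution of [s] carries a binomial coefficient that depends on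
    [s], so no single [M] isolates [w ^ (maj s - exc s)]. An alternating sum over sub-alphabets
    does: it is a finite difference whose order is the degree of that binomial coefficient. Infinite
    products over necklaces would call for power series. Instead, words are functions on Z/(T+1),
    with T+1 a common multiple of all cycle lengths. A primitive necklace of length k becomes a
    shift orbit of k words, and a multiset of necklaces of total length n becomes a multiplicity
    function on words, constant on shift orbits and of sum n. Rotation invariance merely enlarges
    the orbits, so both counts obey one recursion and differ only in its coefficients. The root of
    unity matters there alone, in sums over single words of given period and number of red letters.
    Solving the recursion divides by n, hence characteristic zero. Cycle type and excedances travel
    together in one additive polynomial grade. *)

Lemma sum_sets_inclusion_exclusion (C : comPzRingType) (Y T : finType)
    (P : pred Y) (f : Y -> {set T}) (x : Y -> C) :
  \sum_(A : {set T}) (-1) ^+ #|~: A| * \sum_(y | P y && (f y \subset A)) x y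
    = \sum_(y | P y && (f y == setT)) x y.
Proof.
transitivity (\sum_(A : {set T}) \sum_(y | P y)
    (if f y \subset A then (-1) ^+ #|~: A| * x y else 0)).
  by apply: eq_bigr => A _; rewrite -big_mkcondr mulr_sumr.
rewrite exchange_big [RHS]big_mkcondr /=; apply: eq_bigr => y _.
(* Written as a product over elements, the sign together with its condition lets the sum over [A]
   factor: [t] contributes 1 if it lies in [f y], and 1 - 1 otherwise. *)
have sign (A : {set T}) : \prod_t (if t \in A then 1 else if t \in f y then 0 else -1)
    = (if f y \subset A then (-1) ^+ #|~: A| else 0) :> C.
  case: ifP => [/subsetP sA | /negP/negP/subsetPn[t ty tA]]; last first.
    by rewrite (bigD1 t) //= (negPf tA) ty mul0r.
  rewrite (bigID (mem A)) /= big1 ?mul1r => [|t ->] //.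
  rewrite (eq_bigr (fun=> -1)) => [|t tA]; last first.
    by rewrite (negPf tA); case: ifP => // /sA; rewrite (negPf tA).
  by rewrite prodr_const; congr (_ ^+ _); apply: eq_card => t; rewrite !inE.
transitivity ((\sum_(A : {set T}) (if f y \subset A then (-1) ^+ #|~: A| else 0)) * x y).
  by rewrite mulr_suml; apply: eq_bigr => A _; case: ifP => _ //; rewrite mul0r.
under eq_bigr do rewrite -sign.
rewrite -bigA_distr.
case: eqP => [-> | /eqP neT].
  by rewrite big1 ?mul1r // => t _; rewrite inE /= addr0.
have [t _ ty] : exists2 t, t \in setT & t \notin f y.
  by apply/subsetPn; rewrite subTset.
by rewrite (bigD1 t) //= (negPf ty) subrr !mul0r.
Qed.

(** The binomial coefficient counts the [r]-subsets of a disjoint union of [r] and [c] points whose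
    left part lies in [A]. Inclusion-exclusion keeps those whose left part is everything, and there
    is only one. *)
Lemma alternating_sum_bin (C : comPzRingType) (r c : nat) :
  \sum_(A : {set 'I_r}) (-1) ^+ #|~: A| * 'C(#|A| + c, r)%:R = 1 :> C.
Proof.
pose left (B : {set 'I_r + 'I_c}) : {set 'I_r} := [set i | inl i \in B].
transitivity (\sum_(A : {set 'I_r}) (-1) ^+ #|~: A| *
    \sum_(B : {set 'I_r + 'I_c} | (#|B| == r) && (left B \subset A)) 1 : C).
  apply: eq_bigr => A _; congr (_ * _); rewrite sumr_const; congr _%:R.
  pose D : {set 'I_r + 'I_c} := (inl @: A) :|: (inr @: setT).
  have cD : #|D| = (#|A| + c)%N.
    rewrite cardsU (_ : _ :&: _ = set0) ?cards0 ?subn0; last first.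
      apply/setP => z; rewrite !inE; apply/negP => /andP[/imsetP[i _ ->]].
      by case/imsetP.
    rewrite !card_imset ?cardsT ?card_ord // => [? ? [] | ? ? []] //.
  rewrite -cD -cards_draws -sum1_card -[RHS]sum1_card; apply: eq_bigl => B.
  rewrite !inE andbC; congr (_ && _); apply/subsetP/subsetP => sB.
    move=> i; rewrite inE => /sB; rewrite !inE => /orP[/imsetP[k kA [->]] //|].
    by case/imsetP.
  case=> i iB; rewrite !inE; last by rewrite orbC imset_f.
  by rewrite imset_f // sB // inE.
rewrite (sum_sets_inclusion_exclusion (fun B : {set 'I_r + 'I_c} => #|B| == r) left (fun=> 1)).
rewrite (big_pred1 (inl @: setT)) // => B /=; apply/andP/eqP => [[/eqP cB /eqP lB] | ->].
  apply/esym/eqP; rewrite eqEcard cB card_imset ?cardsT ?card_ord ?leqnn ?andbT //.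
    apply/subsetP => _ /imsetP[i _ ->]; have : i \in left B by rewrite lB inE.
    by rewrite inE.
  by move=> ? ? [].
rewrite card_imset ?cardsT ?card_ord => [|? ? []] //; split=> //.
by apply/eqP/setP => i; rewrite !inE imset_f // inE.
Qed.

End InclusionExclusion.

Section ElementarySymmetric.

Local Open Scope ring_scope.

Lemma prod_1_sub_unity_rootX (C : fieldType) (d : nat) (w : C) :
  d.-primitive_root w -> \prod_(i < d) (1 - w ^+ i *: 'X) = 1 - 'X^d :> {poly C}.
Proof.
move=> pw; have d0 := prim_order_gt0 pw.
have w0 : w != 0.
  apply/eqP => w0; have /eqP := prim_expr_order pw.
  by rewrite w0 expr0n eqn0Ngt d0 eq_sym oner_eq0.
have pv : d.-primitive_root w^-1.
  have -> : w^-1 = w ^+ d.-1.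
    by apply: (mulfI w0); rewrite mulfV // -exprS prednK // prim_expr_order.
  by rewrite prim_root_exp_coprime // coprimePn.
have E : \prod_(i < d) (1 - w ^+ i *: 'X) = (\prod_(i < d) (- w ^+ i)) *: ('X^d - 1) :> {poly C}.
  rewrite -(factor_Xn_sub_1 pv) big_mkord -scaler_prod; apply: eq_bigr => i _.
  rewrite scalerBr scaleNr -mul_polyC -mul_polyC -polyCM mulNr exprVn mulfV ?expf_neq0 //.
  by rewrite polyCN opprK addrC.
rewrite E; have := congr1 (fun p : {poly C} => p.[0]) E.
rewrite horner_prod hornerZ hornerD hornerXn hornerN hornerC expr0n eqn0Ngt d0.
rewrite big1 ?sub0r => [|i _]; last by rewrite !hornerE ?mulr0 ?subr0.
by rewrite mulrN1 => /esym/eqP; rewrite eqr_oppLR => /eqP ->; rewrite scaleN1r opprB.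
Qed.

(** The exponents of the first factor are multiples of [d] and the degree of [q] is below [d], so
    only the constant coefficient of [q] reaches degree [d * k]. *)
Lemma coef_mul_lt_size (C : comNzRingType) (d k : nat) (p q : {poly C}) :
  (size q <= d)%N -> q`_0 = 1 -> ((p \Po 'X^d) * q)`_(d * k) = p`_k.
Proof.
move=> sq q0.
have d0 : (0 < d)%N.
  by apply: leq_trans sq; rewrite lt0n size_poly_eq0; apply: contra_eqN q0 => /eqP ->; rewrite coef0 eq_sym oner_eq0.
rewrite coefM (bigD1 (inord (d * k))) //= inordK // subnn q0 mulr1.
rewrite coef_comp_poly_Xn // dvdn_mulr // mulKn // big1 ?addr0 // => i ne.
rewrite coef_comp_poly_Xn //; case: ifP => [/dvdnP[c ci]|_]; last by rewrite mul0r.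
have lt_i : (i < d * k)%N.
  rewrite ltn_neqAle -ltnS ltn_ord andbT; apply: contraNneq ne => e.
  by apply/eqP/val_inj; rewrite /= inordK // -e.
rewrite [q`__]nth_default ?mulr0 //; apply: leq_trans sq _.
rewrite ci [X in (_ - X)%N]mulnC -mulnBr leq_pmulr // subn_gt0.
by rewrite -(ltn_pmul2l d0) [X in (X < _)%N]mulnC -ci.
Qed.

Lemma coef_1_subX_exp (C : comNzRingType) (M k : nat) :
  ((1 - 'X : {poly C}) ^+ M)`_k = (-1) ^+ k * 'C(M, k)%:R.
Proof.
elim: M k => [|M IH] k.
  by rewrite expr0 coef1 bin0n; case: k => [|k]; rewrite ?mulr1 ?mulr0.
rewrite exprS mulrBl mul1r coefB coefXM IH; case: k => [|k] /=.
  by rewrite !bin0 subr0.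
by rewrite IH binS natrD exprS mulrDr !mulN1r !mulNr.
Qed.

(** The coefficient of degree k is, up to sign, the elementary symmetric function e_k(1, q, ...,
    q^(N-1)), which is a Gaussian binomial coefficient times a power of q. *)
Definition esign_poly (C : comNzRingType) (q : C) (N : nat) : {poly C} :=
  \prod_(i < N) (1 - q ^+ i *: 'X).

Lemma size_esign_poly (C : comNzRingType) (q : C) N : (size (esign_poly q N) <= N.+1)%N.
Proof.
rewrite /esign_poly; elim: N => [|N IH]; first by rewrite big_ord0 size_polyC oner_eq0.
rewrite big_ord_recr /=; apply: leq_trans (size_polyMleq _ _) _.
have : (size (1 - q ^+ N *: 'X : {poly C})%R <= 2)%N.
  apply: leq_trans (size_polyD _ _) _; rewrite geq_max size_polyC oner_eq0 /=.
  by rewrite size_polyN (leq_trans (size_scale_leq _ _)) // size_polyX.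
by case: (size _) IH => [|a] /=; lia.
Qed.

Lemma esign_poly_coef0 (C : comNzRingType) (q : C) N : (esign_poly q N)`_0 = 1.
Proof.
rewrite -horner_coef0 horner_prod big1 // => i _.
by rewrite !hornerE ?mulr0 ?subr0.
Qed.

Lemma esign_poly_coefS (C : comNzRingType) (q : C) N k :
  (esign_poly q N.+1)`_k.+1 = (esign_poly q N)`_k.+1 - q ^+ N * (esign_poly q N)`_k.
Proof.
by rewrite /esign_poly big_ord_recr /= mulrBr mulr1 coefB -scalerAr coefZ coefMX.
Qed.

(** Each run of [d] factors collapses to 1 - X^d, which leaves (1 - X^d)^M times a polynomial of
    degree below [d]. This is the q-Lucas theorem at indices divisible by [d]. *)
Lemma esign_poly_root (C : fieldType) (w : C) (d M r k : nat) :
  d.-primitive_root w -> (r < d)%N ->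
  (esign_poly w (d * M + r))`_(d * k) = (-1) ^+ k * 'C(M, k)%:R.
Proof.
move=> pw ltr; have d0 := prim_order_gt0 pw.
have -> : esign_poly w (d * M + r) = ((1 - 'X) ^+ M \Po 'X^d) * esign_poly w r.
  rewrite /esign_poly; elim: M => [|M IH].
    by rewrite muln0 add0n expr0 rmorph1 mul1r.
  rewrite mulnS -addnA big_split_ord /= prod_1_sub_unity_rootX // exprS.
  rewrite rmorphM /= -mulrA -IH; congr (_ * _).
    by rewrite rmorphB rmorph1 /= comp_polyX.
  by apply: eq_bigr => i _; rewrite exprD prim_expr_order // mul1r.
rewrite coef_mul_lt_size ?esign_poly_coef0 //; last first.
  exact: leq_trans (size_esign_poly _ _) ltr.
exact: coef_1_subX_exp.
Qed.

End ElementarySymmetric.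

(** * Weakly decreasing sequences with prescribed strict drops *)

Section WeaklyDecreasing.

Local Open Scope ring_scope.

Variables (C : comNzRingType) (q : C).

Definition chain n m (D : nat -> bool) (s : {ffun 'I_n -> 'I_m}) : bool :=
  [forall i : 'I_n, forall j : 'I_n, (j == i.+1 :> nat) ==> (s j + D i <= s i)%N].

Definition ffun_cons n (T : finType) (u : T * {ffun 'I_n -> T}) : {ffun 'I_n.+1 -> T} :=
  [ffun i => oapp u.2 u.1 (unlift ord0 i)].

Lemma ffun_cons0 n (T : finType) (u : T * {ffun 'I_n -> T}) : ffun_cons u ord0 = u.1.
Proof. by rewrite ffunE unlift_none. Qed.

Lemma ffun_consS n (T : finType) (u : T * {ffun 'I_n -> T}) i :
  ffun_cons u (lift ord0 i) = u.2 i.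
Proof. by rewrite ffunE liftK. Qed.

Lemma ffun_cons_bij n (T : finType) : bijective (@ffun_cons n T).
Proof.
exists (fun s : {ffun 'I_n.+1 -> T} => (s ord0, [ffun i : 'I_n => s (lift ord0 i)])) => [[x s]|s].
  by rewrite ffun_cons0; congr pair; apply/ffunP => i; rewrite ffunE ffun_consS.
apply/ffunP => i; case: (unliftP ord0 i) => [j ->|->].
  by rewrite ffun_consS ffunE.
by rewrite ffun_cons0.
Qed.

Lemma chain_cons n m (D : nat -> bool) (x : 'I_m) (s : {ffun 'I_n.+1 -> 'I_m}) :
  chain D (ffun_cons (x, s)) = (s ord0 + D 0 <= x)%N && chain (D \o succn) s.
Proof.
apply/'forall_forallP/andP => [H|[H0 /'forall_forallP H] i j].
  split.
    by have /implyP := H ord0 (lift ord0 ord0); rewrite ffun_consS ffun_cons0; apply.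
  apply/'forall_forallP => i j; have := H (lift ord0 i) (lift ord0 j).
  by rewrite !ffun_consS.
apply/implyP; case: (unliftP ord0 j) => [j' ->|->] //=.
case: (unliftP ord0 i) => [i' ->|->].
  by rewrite !ffun_consS /=; move: (H i' j') => /implyP.
rewrite ffun_consS ffun_cons0 /= => /eqP[e].
by rewrite (_ : j' = ord0) //; apply: val_inj.
Qed.

(** The recurrence [esign_poly_coefS] telescopes in [m]; the bound on [e] keeps the natural
    subtraction exact. *)
Lemma sum_esign_poly (n e m : nat) : (e <= n)%N ->
  - (\sum_(s0 < m) q ^+ (s0 + n) * (esign_poly q (s0 + n - e))`_n)
    = q ^+ e * (esign_poly q (m + n - e))`_n.+1.
Proof.
move=> le_en; elim: m => [|m IH].
  rewrite big_ord0 oppr0 nth_default ?mulr0 //.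
  by apply: leq_trans (size_esign_poly _ _) _; rewrite ltnS leq_subr.
rewrite big_ord_recr /= opprD IH.
have -> : (m.+1 + n - e = (m + n - e).+1)%N by lia.
rewrite esign_poly_coefS mulrBr mulrA -exprD; congr (_ - _ * _).
by congr (_ ^+ _); lia.
Qed.

(* [(esign_poly q n.+1)`_n.+1] is, up to sign, [q] to the power [n.+1] choose 2; keeping it as a
   factor avoids dividing by it. *)
Lemma sum_chain (n m K : nat) (D : nat -> bool) : (m <= K)%N ->
  (\sum_(s : {ffun 'I_n.+1 -> 'I_K} | (s ord0 < m)%N && chain D s)
      q ^+ (\sum_i s i)) * (esign_poly q n.+1)`_n.+1
   = q ^+ (\sum_(i < n) D i * i.+1)
       * (esign_poly q (m + n - \sum_(i < n) D i))`_n.+1.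
Proof.
(* The bound [m] on the first value changes in the recursion, whereas [K] stays fixed so that all
   sequences of one length share a type. *)
elim: n m D => [|n IH] m D leK.
  rewrite !big_ord0 expr0 mul1r addn0 subn0.
  rewrite [in LHS]/esign_poly big_ord1 expr0 scale1r coefB coefX coef1 /= sub0r mulrN1.
  have <- : - (\sum_(s0 < m) q ^+ (s0 + 0) * (esign_poly q (s0 + 0 - 0))`_0)
    = (esign_poly q m)`_1.
    by rewrite sum_esign_poly // expr0 mul1r addn0 subn0.
  congr (- _); rewrite (big_ord_widen _ (fun i => q ^+ (i + 0) * (esign_poly q (i + 0 - 0))`_0) leK).
  rewrite (reindex (fun x : 'I_K => [ffun _ : 'I_1 => x])) /=; last first.
    exists (fun s : {ffun 'I_1 -> 'I_K} => s ord0) => [x _|s _].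
      by rewrite ffunE.
    by apply/ffunP => i; rewrite ffunE (ord1 i).
  apply: eq_big => [x|x _].
    rewrite ffunE; case: ltnP => //= _; apply/'forall_forallP => i j.
    by rewrite !ord1.
  by rewrite big_ord1 ffunE addn0 esign_poly_coef0 mulr1.
rewrite (reindex (@ffun_cons _ _)) /=; last exact: onW_bij (ffun_cons_bij _ _).
pose e := (\sum_(i < n.+1) D i)%N; pose e' := (\sum_(i < n) (D \o succn) i)%N.
have ee' : e = (D 0 + e')%N by rewrite /e big_ord_recl.
have le_e' : (e' <= n)%N.
  rewrite -[leqRHS]card_ord -sum1_card; apply: leq_sum => i _; exact: leq_b1.
have le_e : (e <= n.+1)%N by rewrite ee'; case: (D 0); lia.
transitivity (- (\sum_(s0 < m) q ^+ (s0 + n.+1) * (esign_poly q (s0 + n.+1 - e))`_n.+1) * q ^+ (\sum_(i < n) (D \o succn) i * i.+1)).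
  (* One more factor multiplies the top coefficient by [- q ^+ n.+1]; this provides both the sign
     and the power of [q] that [sum_esign_poly] consumes. *)
  rewrite esign_poly_coefS [_`_n.+2]nth_default ?size_esign_poly // sub0r.
  rewrite mulrN mulNr; congr (- _).
  rewrite (big_ord_widen _ (fun s0 => q ^+ (s0 + n.+1) * (esign_poly q (s0 + n.+1 - e))`_n.+1) leK) /=.
  rewrite mulr_suml mulr_suml.
  transitivity (\sum_(x : 'I_K | (x < m)%N) \sum_(s : {ffun 'I_n.+1 -> 'I_K} |
     (s ord0 + D 0 <= x)%N && chain (D \o succn) s)
     q ^+ (x + \sum_i s i) * (q ^+ n.+1 * (esign_poly q n.+1)`_n.+1)).
    rewrite pair_big_dep /=; apply: eq_big => [[x s]|[x s] _] /=.
      by rewrite ffun_cons0 chain_cons.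
    congr (q ^+ _ * _); rewrite big_ord_recl ffun_cons0 /=; congr (_ + _)%N.
    by apply: eq_bigr => i _; rewrite ffun_consS.
  apply: eq_bigr => x ltx.
  transitivity (q ^+ (x + n.+1) * ((\sum_(s : {ffun 'I_n.+1 -> 'I_K} |
     (s ord0 < x.+1 - D 0)%N && chain (D \o succn) s) q ^+ (\sum_i s i))
       * (esign_poly q n.+1)`_n.+1)).
    rewrite mulr_suml mulr_sumr; apply: eq_big => [s|s _].
      by congr (_ && _); case: (D 0); lia.
    by rewrite !exprD; ring.
  rewrite IH; last by have := ltn_ord x; lia.
  rewrite -/e'; have -> : (x.+1 - D 0 + n - e' = x + n.+1 - e)%N by rewrite ee'; case: (D 0); lia.
  by rewrite mulrCA mulrC.
rewrite sum_esign_poly // -/e mulrAC -exprD; congr (q ^+ _ * _).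
rewrite ee' [in RHS]big_ord_recl muln1 -addnA /e' -big_split /=; congr (_ + _)%N.
by apply: eq_bigr => i _; rewrite /bump /= !add1n [RHS]mulnS.
Qed.

End WeaklyDecreasing.

(** * Labellings compatible with a permutation, and the set DEX *)

Section Standard.

Variable n : nat.
Implicit Types (s : 'S_n) (i j k : 'I_n).

Definition excb s i : bool := i < s i.

(** The order imposed on positions with equal letters: red ones precede blue ones, and within a
    colour the images under [s] increase. *)
Definition red_before s i j : bool :=
  (excb s i && ~~ excb s j) || ((excb s i == excb s j) && (s i < s j)).

Lemma red_before_trans s : transitive (red_before s).
Proof.
move=> j i k; rewrite /red_before; case: (excb s i); case: (excb s j); case: (excb s k) => //=;
  exact: ltn_trans.
Qed.

(* [f] is weakly decreasing, strictly so after each position of the set DEX of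
   Shareshian and Wachs, whose members are the [i] with [dexb s i]. *)
Definition standard m s (f : {ffun 'I_n -> 'I_m}) : bool :=
  [forall i : 'I_n, forall j : 'I_n, (i < j) ==> (f j < f i) || ((f j == f i) && red_before s i j)].

Definition dexb s (p : nat) : bool :=
  [exists i : 'I_n, exists j : 'I_n, [&& i == p :> nat, j == p.+1 :> nat & ~~ red_before s i j]].

Lemma dexbE s i j : j = i.+1 :> nat -> dexb s i = ~~ red_before s i j.
Proof.
move=> ij; apply/existsP/idP => [[i' /existsP[j' /and3P[/eqP ei /eqP ej]]]|nr].
  by rewrite (val_inj ei : i' = i) (_ : j' = j) //; apply: val_inj; rewrite /= ej.
by exists i; apply/existsP; exists j; rewrite eqxx ij eqxx.
Qed.

(** Transitivity of [red_before] reduces the condition on all pairs to consecutive positions. *)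
Lemma standard_chain m s (f : {ffun 'I_n -> 'I_m}) : standard s f = chain (dexb s) f.
Proof.
apply/'forall_forallP/'forall_forallP => H i j; apply/implyP.
  move=> /eqP ij; have /implyP := H i j; rewrite ij => /(_ (ltnSn _)).
  rewrite (dexbE s ij) => /orP[lt|/andP[/eqP -> ->]]; last by rewrite addn0.
  by case: (red_before _ _ _); rewrite ?addn0 ?addn1 // ltnW.
move=> ij; have [k ejk] : exists k : nat, (j = (i + k).+1 :> nat) by exists (j - i.+1); lia.
elim: k j ejk {ij} => [|k IH] j ejk.
  have ij : j = i.+1 :> nat by rewrite ejk addn0.
  have /implyP := H i j; rewrite ij eqxx => /(_ isT); rewrite (dexbE s ij).
  case: (red_before s i j); rewrite ?addn1 ?addn0 /= ?andbF ?orbF //.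
  by rewrite leq_eqVlt andbT orbC => /orP[->|/eqP/val_inj ->]; rewrite ?eqxx ?orbT.
have lt' : j.-1 < n by rewrite (leq_ltn_trans (leq_pred _)).
pose j' := Ordinal lt'; have ej' : j = j'.+1 :> nat by rewrite /= ejk.
have {}IH := IH j' (_ : _ = _ :> nat).
have /implyP := H j' j; rewrite ej' eqxx => /(_ isT); rewrite (dexbE s ej').
have : (j' : nat) = (i + k).+1 by rewrite /= ejk addnS.
move=> /IH/orP[lt|/andP[/eqP e r]].
  by move=> le; rewrite (leq_ltn_trans _ lt) // (leq_trans (leq_addr _ _) le).
case r2: (red_before s j' j); rewrite /= ?addn1 ?addn0; last by move=> lt; rewrite -e lt.
rewrite (red_before_trans r r2) andbT orbC -e leq_eqVlt => /orP[/eqP/val_inj ->|->];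
  by rewrite ?eqxx ?orbT.
Qed.

End Standard.

(* [Des s] and [DEX s] differ exactly where the excedance status changes, so the difference
   of the two sums telescopes. *)
Lemma maj_dexb n (s : 'S_n.+1) :
  maj s = \sum_(p < n) dexb s p * p.+1 + exc s.
Proof.
(* The excedance status is extended to natural numbers; it is false at the last position, which
   removes the boundary term of the telescoping sum. *)
pose e p := if insub p is Some i then excb s i else false.
have eE (i : 'I_n.+1) : e i = excb s i by rewrite /e valK.
have en : e n = false.
  by have := eE ord_max; rewrite /= => ->; rewrite /excb /= ltnNge -ltnS ltn_ord.
have excE : exc s = \sum_(p < n) e p.
  rewrite /exc -sum1_card; transitivity (\sum_(p < n.+1) e p).
    rewrite big_mkcond; apply: eq_bigr => i _; rewrite inE eE /excb.
    rewrite andb_idl => [|lt]; first by case: (i < s i).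
    exact: leq_ltn_trans lt (ltn_ord _).
  by rewrite big_ord_recr /= en addn0.
pose des p := (s (inord p.+1) < s (inord p)).
have majE : maj s = \sum_(p < n) des p * p.+1.
  rewrite /maj big_mkcond big_ord_recr /= inE ltnn /= addn0; apply: eq_bigr => p _.
  rewrite inE /= ltnS ltn_ord /= /des.
  have -> : inord p = widen_ord (leqnSn n) p by apply: val_inj; rewrite /= inordK // ltnW // ltnS.
  have -> : ordS (widen_ord (leqnSn n) p) = inord p.+1.
    by apply: val_inj; rewrite /= inordK ?modn_small // ltnS.
  by case: ifP => _; rewrite ?mul1n ?mul0n.
have step (p : 'I_n) : des p + e p.+1 = dexb s p + e p.
  have ep : (inord p : 'I_n.+1) = p :> nat by rewrite inordK // ltnW // ltnS.
  have ep1 : (inord p.+1 : 'I_n.+1) = p.+1 :> nat by rewrite inordK // ltnS.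
  have := eE (inord p); have := eE (inord p.+1).
  have := @dexbE _ s (inord p) (inord p.+1); rewrite ep ep1 => /(_ (erefl _)) -> -> ->.
  have ne : inord p != inord p.+1 :> 'I_n.+1 by rewrite -val_eqE /= ep ep1 neq_ltn ltnSn.
  have {ne} : s (inord p) != s (inord p.+1) by rewrite (inj_eq perm_inj).
  rewrite -val_eqE /= /red_before /excb /des ep ep1.
  by lia.
rewrite majE excE.
have tel : \sum_(p < n) e p.+1 * p.+1 = \sum_(p < n) e p * p.
  transitivity (\sum_(p < n.+1) e p * p).
    by rewrite big_ord_recl muln0 add0n; apply: eq_bigr => p _; rewrite lift0.
  by rewrite big_ord_recr /= en mul0n addn0.
apply/eqP; rewrite -(eqn_add2r (\sum_(p < n) e p.+1 * p.+1)) -big_split /=.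
rewrite [X in _ == _ + X]tel -addnA -!big_split /=; apply/eqP; apply: eq_bigr => p _.
by rewrite -mulnDl step; lia.
Qed.

Section StandardSum.

Local Open Scope ring_scope.

(** The members of DEX sum to [maj s - exc s] by [maj_dexb], and only their number enters [c]. What
    matters later is that [c] does not depend on [M]. *)
Lemma sum_standard (C : fieldType) (d n : nat) (w : C) (s : 'S_(d * n)) :
  d.-primitive_root w -> (0 < n)%N ->
  exists c, forall M,
    \sum_(f : {ffun 'I_(d * n) -> 'I_(d * M)} | standard s f) w ^+ (\sum_i f i)
      = w ^+ (maj s - exc s) * 'C(M + c, n)%:R.
Proof.
move=> pw n0; have d0 := prim_order_gt0 pw.
have dn0 : (0 < d * n)%N by rewrite muln_gt0 d0.
have [N eN] : exists N, (d * n = N.+1)%N by exists (d * n).-1; rewrite prednK.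
pose e := (\sum_(p < N) dexb s p)%N.
have le_e : (e <= N)%N.
  by rewrite -[leqRHS]card_ord -sum1_card; apply: leq_sum => i _; exact: leq_b1.
(* Since N = d n - 1, dividing d M + N - e by d gives the quotient M + c for this c and the
   remainder d - 1 - (e mod d). The subtraction is exact because e <= N. *)
exists (n - (e %/ d).+1)%N => M.
have me : maj s = (\sum_(p < N) dexb s p * p.+1 + exc s)%N.
  by move: s {e le_e}; rewrite eN => s; exact: maj_dexb.
rewrite me addnK.
(* At the root of unity this coefficient is a sign, so the factor carried along by [sum_chain] can
   be cancelled. *)
have top : (esign_poly w (d * n))`_(d * n) != 0 :> C.
  by rewrite -{1}[(d * n)%N]addn0 esign_poly_root // binn mulr1 signr_eq0.
apply: (mulIf top).
have -> : (\sum_(f : {ffun 'I_(d * n) -> 'I_(d * M)} | standard s f) w ^+ (\sum_i f i))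
    * (esign_poly w (d * n))`_(d * n)
  = w ^+ (\sum_(p < N) dexb s p * p.+1) * (esign_poly w (d * M + N - e))`_(d * n).
  rewrite /e; move: s {e le_e me top}; rewrite eN => s.
  rewrite -(@sum_chain _ w _ _ _ (dexb s) (leqnn (d * M))); congr (_ * _); apply: eq_bigl => f.
  by rewrite standard_chain ltn_ord.
rewrite -mulrA; congr (_ * _).
have lt_q : (e %/ d < n)%N by rewrite ltn_divLR // mulnC eN ltnS.
have -> : (d * M + N - e = d * (M + (n - (e %/ d).+1)) + (d.-1 - e %% d))%N.
  have := ltn_pmod e d0; have := divn_eq e d; nia.
rewrite esign_poly_root //; last by lia.
rewrite mulrC -{1}[(d * n)%N]addn0 esign_poly_root // binn mulr1.
by [].
Qed.

End StandardSum.

(** * Orbits of commuting permutations *)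

Section PermOrbits.

Local Open Scope ring_scope.

Variables (X : finType) (s : {perm X}).

Lemma big_traject (V : nmodType) (h : X -> V) (f : X -> X) x n :
  \sum_(y <- traject f x n) h y = \sum_(i < n) h (iter i f x).
Proof.
elim: n => [|n IH]; first by rewrite big_nil big_ord0.
by rewrite trajectSr -cats1 big_cat big_seq1 IH big_ord_recr.
Qed.

Lemma sum_porbit (V : nmodType) (h : X -> V) x :
  \sum_(y in porbit s x) h y = \sum_(i < #|porbit s x|) h ((s ^+ i)%g x).
Proof.
rewrite (eq_bigl _ _ (porbit_traject s x)) -big_uniq ?uniq_traject_porbit //.
by rewrite big_traject; apply: eq_bigr => i _; rewrite permX.
Qed.

Lemma perm_exp_fix c x : ((s ^+ c)%g x == x) = (#|porbit s x| %| c)%N.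
Proof.
have it c' : (s ^+ c')%g x = iter c' s x by rewrite permX.
have p0 : (0 < #|porbit s x|)%N by apply/card_gt0P; exists x; apply: porbit_id.
have pq q : (s ^+ (#|porbit s x| * q))%g x = x.
  elim: q => [|q IH]; first by rewrite muln0 expg0 perm1.
  by rewrite mulnS expgD permM it iter_porbit IH.
have -> : (s ^+ c)%g x = (s ^+ (c %% #|porbit s x|)%N)%g x.
  by rewrite {1}(divn_eq c #|porbit s x|) expgD permM mulnC pq.
rewrite /dvdn; apply/eqP/eqP => [|->]; last by rewrite expg0 perm1.
have lt : (c %% #|porbit s x| < #|porbit s x|)%N by rewrite ltn_pmod.
have := uniq_traject_porbit s x.
move=> /uniqP-/(_ x)/(_ (c %% #|porbit s x|)%N 0%N).
by rewrite !inE !size_traject p0 lt !nth_traject // it => H /H->.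
Qed.

End PermOrbits.

Section CommutingPerms.

Local Open Scope ring_scope.

Variables (X : finType) (s r : {perm X}).
Hypothesis rs : commute r s.

Lemma porbit_perm_image x : r @: porbit s x = porbit s (r x).
Proof.
have E c : r ((s ^+ c)%g x) = (s ^+ c)%g (r x).
  by rewrite -!permM; congr (fun_of_perm _ x); apply/esym/commuteX.
apply/setP => y; apply/imsetP/porbitP => [[_ /porbitP[c ->] ->]|[c ->]].
  by exists c.
by exists ((s ^+ c)%g x); rewrite ?mem_porbit.
Qed.

Definition image_perm : {perm {set X}} := perm (imset_inj (@perm_inj _ r)).

Lemma image_perm_porbit c x :
  (image_perm ^+ c)%g (porbit s x) = porbit s ((r ^+ c)%g x).
Proof.
elim: c => [|c IH]; first by rewrite !expg0 !perm1.
by rewrite !expgSr !permM IH permE porbit_perm_image.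
Qed.

(** The orbit of [x] under the group generated by [r] and [s], kept as a union of [s]-orbits: [r]
    permutes these because it commutes with [s]. *)
Definition orbit2 x : {set X} := cover (porbit image_perm (porbit s x)).

Definition orbit2_index x : nat := #|porbit image_perm (porbit s x)|.

Lemma orbit2P x y : reflect (exists c, porbit s y = porbit s ((r ^+ c)%g x)) (y \in orbit2 x).
Proof.
apply: (iffP bigcupP) => [[A /porbitP[c ->]]|[c e]].
  by rewrite image_perm_porbit -eq_porbit_mem => /eqP ->; exists c.
exists (porbit s ((r ^+ c)%g x)); last by rewrite -e porbit_id.
by rewrite -image_perm_porbit mem_porbit.
Qed.

Lemma orbit2_refl x : x \in orbit2 x.
Proof. by apply/orbit2P; exists 0%N; rewrite expg0 perm1. Qed.

Lemma orbit2_eq x y : y \in orbit2 x -> orbit2 y = orbit2 x.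
Proof.
case/orbit2P => c e; rewrite /orbit2 e -image_perm_porbit.
by congr (cover _); apply/eqP; rewrite eq_porbit_mem mem_porbit.
Qed.

Lemma orbit2_index_dvd c x : (orbit2_index x %| c)%N = ((r ^+ c)%g x \in porbit s x).
Proof.
by rewrite -eq_porbit_mem -image_perm_porbit perm_exp_fix.
Qed.

Lemma sum_orbit2 (V : nmodType) (h : X -> V) x c :
  (forall i, \sum_(y in porbit s ((r ^+ i)%g x)) h y = c) ->
  \sum_(y in orbit2 x) h y = c *+ orbit2_index x.
Proof.
move=> hc; rewrite big_trivIset /=; last first.
  apply/trivIsetP => _ _ /porbitP[i ->] /porbitP[j ->].
  rewrite !image_perm_porbit => ne; apply/pred0P => z /=; apply: contraNF ne.
  by rewrite -!eq_porbit_mem => /andP[/eqP <-].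
rewrite (eq_bigr (fun=> c)) ?sumr_const // => _ /porbitP[i ->].
by rewrite image_perm_porbit.
Qed.

End CommutingPerms.

(** * Newton's recursion for invariant multisets *)

(** In this form a multiplicity becomes a sum over the possible numbers of copies to remove. *)
Lemma card_ord_pos K (m : 'I_K.+1) : (m = \sum_(i < K.+1 | (0 < i) && (i <= m)) 1 :> nat)%N.
Proof.
rewrite -(big_ord_widen_cond K.+1 (fun i => 0 < i)%N (fun=> 1%N) (ltn_ord m)).
by rewrite big_mkcond big_ord_recl sum1_card card_ord.
Qed.

Section InvariantMultisets.

Local Open Scope ring_scope.

Variables (X : finType) (O : X -> {set X}) (W : {set X}).
Hypothesis O_refl : forall a, a \in O a.
Hypothesis O_eq : forall a b, b \in O a -> O b = O a.
Hypothesis W_O : forall a b, b \in O a -> a \in W -> b \in W.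

Variables (K : nat) (V : zmodType) (g : X -> V) (R : comPzRingType) (x : X -> R).
Implicit Types (N : {ffun X -> 'I_K.+1}) (n : nat) (v : V).

(** The orbits enter as a map [O], so that one theory serves shift orbits and joint orbits of shift
    and rotation. [K] bounds the multiplicities only to make the type finite; nothing is lost while
    n <= K. *)
Definition invariant_multiset n v N : bool :=
  [&& [forall a, forall b, (b \in O a) ==> (N b == N a)],
      [forall a, (a \notin W) ==> (N a == 0%N :> nat)],
      (\sum_a N a == n)%N & \sum_a g a *+ N a == v].

Definition multiset_sum n v : R :=
  \sum_(N | invariant_multiset n v N) \prod_a x a ^+ N a.

Lemma invariant_multisetP n v N :
  reflect [/\ forall a b, b \in O a -> N b = N a,
              forall a, a \notin W -> N a = 0%N :> nat,
              (\sum_a N a = n)%N & \sum_a g a *+ N a = v]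
          (invariant_multiset n v N).
Proof.
apply: (iffP and4P) => [[/'forall_forallP H1 /forallP H2 /eqP H3 /eqP H4]|[H1 H2 H3 H4]]; split=> //.
- by move=> a b ba; have /implyP/(_ ba)/eqP := H1 a b.
- by move=> a aW; have /implyP/(_ aW)/eqP := H2 a.
- by apply/'forall_forallP => a b; apply/implyP => /H1 ->.
- by apply/forallP => a; apply/implyP => /H2 ->.
- exact/eqP.
- exact/eqP.
Qed.

Lemma sum_orbit_add (U : nmodType) (h : X -> U) (w : X) i (N N' : X -> nat) :
  (forall a, N a = N' a + (a \in O w) * i)%N ->
  \sum_a h a *+ N a = \sum_a h a *+ N' a + (\sum_(a in O w) h a) *+ i.
Proof.
move=> NN'; rewrite -sumrMnl [X in _ = _ + X]big_mkcond -big_split /=.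
apply: eq_bigr => a _; rewrite NN' mulrnDr; congr (_ + _).
by case: ifP => _; rewrite ?mul1n ?mul0n.
Qed.

Lemma mem_orbit_eq w a b : b \in O a -> (b \in O w) = (a \in O w).
Proof.
move=> ba; apply/idP/idP => h; first by rewrite -(O_eq h) (O_eq ba) O_refl.
by rewrite -(O_eq h).
Qed.

Definition orbit_add w i N : {ffun X -> 'I_K.+1} :=
  [ffun a => inord (N a + (a \in O w) * i)].

Definition orbit_sub w i N : {ffun X -> 'I_K.+1} :=
  [ffun a => inord (N a - (a \in O w) * i)].

Lemma orbit_subE w i N a : orbit_sub w i N a = (N a - (a \in O w) * i)%N :> nat.
Proof. by rewrite ffunE inordK // (leq_ltn_trans (leq_subr _ _)). Qed.

Section Orbit.

Variables (n : nat) (v : V) (w : X) (i : nat).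
Hypotheses (ltnK : (n <= K)%N) (wW : w \in W).

Let n' := (n - i * #|O w|)%N.
Let v' := v - (\sum_(a in O w) g a) *+ i.

Lemma orbit_sub_ok N : invariant_multiset n v N -> (i <= N w)%N ->
  [/\ (i * #|O w| <= n)%N, invariant_multiset n' v' (orbit_sub w i N),
      (forall a, N a = orbit_sub w i N a + (a \in O w) * i :> nat)%N
    & orbit_add w i (orbit_sub w i N) = N].
Proof.
case/invariant_multisetP => H1 H2 H3 H4 leN.
have E a : (N a = orbit_sub w i N a + (a \in O w) * i :> nat)%N.
  rewrite orbit_subE subnK //; case aw: (a \in O w) => //=.
  by rewrite mul1n (H1 _ _ aw).
have sumE : (\sum_a N a = \sum_a orbit_sub w i N a + i * #|O w|)%N.
  rewrite (eq_bigr _ (fun a _ => E a)) big_split /=; congr (_ + _)%N.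
  by rewrite -big_distrl /= mulnC -sum1_card [in RHS]big_mkcond /=.
split=> //.
- by rewrite -H3 sumE leq_addl.
- apply/invariant_multisetP; split.
  + move=> a b ba; apply: val_inj; rewrite /= !orbit_subE (H1 _ _ ba).
    by rewrite (mem_orbit_eq w ba).
  + by move=> a aW; rewrite orbit_subE H2.
  + by rewrite /n' -H3 sumE addnK.
  + rewrite /v' -H4 (sum_orbit_add g (N := fun a => N a) E) addrK //.
by apply/ffunP => a; apply: val_inj; rewrite ffunE -E /= inordK.
Qed.

Lemma orbit_add_ok N : (i * #|O w| <= n)%N -> invariant_multiset n' v' N ->
  [/\ invariant_multiset n v (orbit_add w i N), (i <= orbit_add w i N w)%N
    & orbit_sub w i (orbit_add w i N) = N].
Proof.
move=> le_i /invariant_multisetP[H1 H2 H3 H4].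
have cO : (0 < #|O w|)%N by apply/card_gt0P; exists w.
have E a : (orbit_add w i N a = N a + (a \in O w) * i :> nat)%N.
  rewrite ffunE inordK // ltnS (leq_trans _ ltnK) // -(subnK le_i) leq_add //.
    by rewrite -/n' -H3 (bigD1 a) //= leq_addr.
  by case: (a \in O w); rewrite ?mul0n // mul1n leq_pmulr.
have sumE : (\sum_a orbit_add w i N a = \sum_a N a + i * #|O w|)%N.
  rewrite (eq_bigr _ (fun a _ => E a)) big_split /=; congr (_ + _)%N.
  by rewrite -big_distrl /= mulnC -sum1_card [in RHS]big_mkcond /=.
split; first (apply/invariant_multisetP; split).
- move=> a b ba; apply: val_inj; rewrite /= !E (H1 _ _ ba).
  by rewrite (mem_orbit_eq w ba).
- move=> a aW; rewrite E H2 //; case aw: (a \in O w) => //.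
  by rewrite (W_O aw) in aW.
- by rewrite sumE H3 /n' subnK.
- by rewrite (sum_orbit_add g E) H4 subrK.
- by rewrite E O_refl mul1n leq_addl.
by apply/ffunP => a; apply: val_inj; rewrite /= orbit_subE E addnK.
Qed.

(** By invariance, a multiset that contains [w] at least [i] times contains [i] copies of the whole
    orbit. Removing them is a bijection that splits off their weight and their grade. *)
Lemma multiset_sum_orbit :
  \sum_(N | invariant_multiset n v N && (i <= N w)%N) \prod_a x a ^+ N a
  = if (i * #|O w| <= n)%N then (\prod_(a in O w) x a) ^+ i * multiset_sum n' v' else 0.
Proof.
case: ifP => [le_i|/negbT nle]; last first.
  by rewrite big_pred0 // => N; apply: contraNF nle => /andP[mN /orbit_sub_ok[]].
rewrite (reindex_onto (orbit_add w i) (orbit_sub w i)) => [|N /andP[mN /orbit_sub_ok[]] //].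
rewrite mulr_sumr; apply: eq_big => [N|N].
  apply/andP/idP => [[/andP[mN leN] /eqP <-]|mN].
    by have [] := orbit_sub_ok mN leN.
  by have [-> -> ->] := orbit_add_ok le_i mN.
move=> /andP[/andP[mN leN] /eqP e]; have [_ _ E _] := orbit_sub_ok mN leN.
rewrite -prodrXl [X in _ = X * _]big_mkcond -big_split /=; apply: eq_bigr => a _.
rewrite E e exprD mulrC; congr (_ * _).
by case: ifP => _; rewrite ?mul1n ?mul0n ?expr0.
Qed.

End Orbit.

(* Count the pairs of an element [w] and a number [i] of copies of its orbit to remove. *)
Lemma newton_recursion n v : (n <= K)%N ->
  n%:R * multiset_sum n v =
  \sum_(w in W) \sum_(i < K.+1 | (0 < i)%N && (i * #|O w| <= n)%N)
     (\prod_(a in O w) x a) ^+ i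
       * multiset_sum (n - i * #|O w|) (v - (\sum_(a in O w) g a) *+ i).
Proof.
move=> leK; rewrite mulr_sumr.
transitivity (\sum_(N | invariant_multiset n v N) \sum_(w in W)
   \sum_(i < K.+1 | (0 < i)%N && (i <= N w)%N) \prod_a x a ^+ N a).
  apply: eq_bigr => N /invariant_multisetP[_ H2 H3 _].
  rewrite -H3 natr_sum mulr_suml (bigID (mem W)) /= [X in _ + X]big1 ?addr0; last first.
    by move=> a aW; rewrite H2 // mul0r.
  apply: eq_bigr => a _; rewrite sumr_const mulr_natl; congr (_ *+ _).
  by rewrite -sum1_card -card_ord_pos.
rewrite exchange_big; apply: eq_bigr => w wW.
rewrite (exchange_big_dep (fun i : 'I_K.+1 => (0 < i)%N)) /=; last by move=> ? ? _ /andP[].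
rewrite [RHS]big_mkcondr /=; apply: eq_bigr => i i0.
rewrite -multiset_sum_orbit //; apply: eq_bigl => N; by rewrite i0.
Qed.

End InvariantMultisets.

(** * Bicolored words as closed walks on a circle *)

Section Words.

Variables (m T : nat).

Definition bword : finType := {ffun 'I_T.+1 -> 'I_m * bool}.
Implicit Types (w : bword) (p q k l : nat).

Definition ltr w p : 'I_m := (w (inZp p)).1.
Definition bit w p : bool := (w (inZp p)).2.

Lemma inZp_mod p : inZp (p %% T.+1) = inZp p :> 'I_T.+1.
Proof. by apply: val_inj; rewrite /= modn_mod. Qed.

Lemma bword_ext w w' :
  (forall p, ltr w p = ltr w' p) -> (forall p, bit w p = bit w' p) -> w = w'.
Proof.
move=> Hl Hb; apply/ffunP => p; rewrite -(valZpK p).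
by have := Hl p; have := Hb p; rewrite /ltr /bit; case: (w _) (w' _) => [? ?] [? ?] /= -> ->.
Qed.

Lemma ltr_modT w p : ltr w (p %% T.+1) = ltr w p.
Proof. by rewrite /ltr inZp_mod. Qed.

Lemma bit_modT w p : bit w (p %% T.+1) = bit w p.
Proof. by rewrite /bit inZp_mod. Qed.

Definition shift_fun (c : nat) w : bword := [ffun p : 'I_T.+1 => w (inZp (p + c))].

Lemma ltr_shift_fun c w p : ltr (shift_fun c w) p = ltr w (p + c).
Proof. by rewrite /ltr ffunE /=; congr (w _).1; apply: val_inj; rewrite /= modnDml. Qed.

Lemma bit_shift_fun c w p : bit (shift_fun c w) p = bit w (p + c).
Proof. by rewrite /bit ffunE /=; congr (w _).2; apply: val_inj; rewrite /= modnDml. Qed.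

Lemma shift_inj : injective (shift_fun 1).
Proof.
move=> w w' e; apply: bword_ext => p.
  have := congr1 (fun w => ltr w (p + T)) e; rewrite !ltr_shift_fun -addnA addn1.
  by rewrite -ltr_modT modnDr ltr_modT -(ltr_modT w') modnDr ltr_modT.
have := congr1 (fun w => bit w (p + T)) e; rewrite !bit_shift_fun -addnA addn1.
by rewrite -bit_modT modnDr bit_modT -(bit_modT w') modnDr bit_modT.
Qed.

Definition shift : {perm bword} := perm shift_inj.

Lemma ltr_shift c w p : ltr ((shift ^+ c)%g w) p = ltr w (p + c).
Proof.
elim: c p => [|c IH] p; first by rewrite expg0 perm1 addn0.
by rewrite expgSr permM permE ltr_shift_fun IH addn1 addSnnS.
Qed.

Lemma bit_shift c w p : bit ((shift ^+ c)%g w) p = bit w (p + c).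
Proof.
elim: c p => [|c IH] p; first by rewrite expg0 perm1 addn0.
by rewrite expgSr permM permE bit_shift_fun IH addn1 addSnnS.
Qed.

Lemma shiftT : (shift ^+ T.+1 = 1)%g.
Proof.
apply/permP => w; rewrite perm1; apply: bword_ext => p.
  by rewrite ltr_shift -ltr_modT modnDr ltr_modT.
by rewrite bit_shift -bit_modT modnDr bit_modT.
Qed.

Definition rot_ltr r (x : 'I_m) : 'I_m := iter r (@ordS m) x.

Lemma val_rot_ltr r x : rot_ltr r x = (x + r) %% m :> nat.
Proof.
elim: r => [|r IH] /=; first by rewrite addn0 modn_small.
by rewrite IH -addn1 modnDml addn1 addnS.
Qed.

Lemma rot_ltr_inj r : injective (rot_ltr r).
Proof. by elim: r => [|r IH] x y //= /ordS_inj/IH. Qed.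

Definition rot_fun r w : bword := [ffun p => (rot_ltr r (w p).1, (w p).2)].

Lemma rot_fun_inj r : injective (rot_fun r).
Proof.
move=> w w' /ffunP e; apply/ffunP => p; have := e p; rewrite !ffunE.
by case: (w p) (w' p) => [? ?] [? ?] /= [/rot_ltr_inj -> ->].
Qed.

Definition wrot r : {perm bword} := perm (@rot_fun_inj r).

Lemma ltr_wrot r i w p : ltr ((wrot r ^+ i)%g w) p = (ltr w p + i * r) %% m :> nat.
Proof.
elim: i => [|i IH]; first by rewrite expg0 perm1 addn0 modn_small.
rewrite expgSr permM permE /ltr ffunE /= val_rot_ltr IH modnDml mulSn.
by rewrite -addnA [i * r + r]addnC.
Qed.

Lemma bit_wrot r i w p : bit ((wrot r ^+ i)%g w) p = bit w p.
Proof.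
elim: i => [|i IH]; first by rewrite expg0 perm1.
by rewrite expgSr permM permE /bit ffunE /= -/(bit _ _) IH.
Qed.

Lemma wrot_shift r : commute (wrot r) shift.
Proof.
apply/permP => w; rewrite !permM; apply: bword_ext => p.
  apply: val_inj; rewrite -[shift]expg1 -[wrot r]expg1 /=.
  by rewrite ltr_shift !ltr_wrot ltr_shift.
by rewrite -[shift]expg1 -[wrot r]expg1 bit_shift !bit_wrot bit_shift.
Qed.

(* A letter followed by a smaller (larger) one is necessarily red (blue), so the colour only
   has to be recorded, by [bit], when the next letter is equal; in this encoding rotation
   does not touch the bits. *)
Definition valid w : bool := [forall p : 'I_T.+1, bit w p ==> (ltr w p.+1 == ltr w p)].

Lemma validP w : reflect (forall p, bit w p -> ltr w p.+1 = ltr w p) (valid w).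
Proof.
apply: (iffP forallP) => H p; last by apply/implyP => /H ->.
have /implyP := H (inZp p); rewrite /= bit_modT ltr_modT -addn1 -ltr_modT modnDml ltr_modT addn1.
by move=> h /h /eqP.
Qed.

Definition red w p : bool := (ltr w p.+1 < ltr w p) || bit w p.

(* The length of the walk from a letter to the next one; it is [m] rather than [0] for a red
   letter followed by an equal one. *)
Definition step w p : nat := (ltr w p.+1 + (m - ltr w p)) %% m + bit w p * m.

(** Red letters are exactly those whose step passes the origin of the circle; summing this makes
    [redn] a winding number. *)
Lemma step_red w p : valid w -> ltr w p + step w p = ltr w p.+1 + red w p * m.
Proof.
move=> /validP/(_ p); rewrite /step /red.
have := ltn_ord (ltr w p); have := ltn_ord (ltr w p.+1).
case: (bit w p) => [ltm _ ->//|].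
  by rewrite subnKC ?modnn ?orbT // ltnW.
rewrite orbF mul0n addn0 => lt1 lt0 _; case: ltnP => le.
  by rewrite modn_small; lia.
have -> : ltr w p.+1 + (m - ltr w p) = m + (ltr w p.+1 - ltr w p) by lia.
by rewrite modnDl modn_small; lia.
Qed.

Lemma step_bit w p : valid w -> bit w p = (step w p == m).
Proof.
have m0 : 0 < m by apply: leq_ltn_trans (ltn_ord (ltr w p)).
move=> /validP/(_ p); rewrite /step; case: (bit w p) => [->//|_].
  by rewrite subnKC ?modnn ?mul1n ?eqxx // ltnW.
by rewrite mul0n addn0 ltn_eqF // ltn_pmod.
Qed.

Lemma step_le w p : valid w -> step w p <= m.
Proof.
have m0 : 0 < m by apply: leq_ltn_trans (ltn_ord (ltr w p)).
move=> vw; have := step_bit p vw; rewrite /step; case: (bit w p); last first.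
  by rewrite mul0n addn0 ltnW // ltn_pmod.
by move=> /esym/eqP ->.
Qed.

Definition redn w k : nat := \sum_(p < k) red w p.

Lemma sum_step w k : valid w -> ltr w 0 + \sum_(p < k) step w p = ltr w k + redn w k * m.
Proof.
move=> vw; rewrite /redn; elim: k => [|k IH]; first by rewrite !big_ord0.
by rewrite !big_ord_recr /= addnA IH addnAC step_red // mulnDl addnAC addnA.
Qed.

(** The letters are the start plus partial sums of steps modulo [m], and a bit is set exactly at a
    full turn, so start and steps determine a valid word. *)
Lemma valid_ext w w' : valid w -> valid w' -> ltr w 0 = ltr w' 0 ->
  (forall p, step w p = step w' p) -> w = w'.
Proof.
move=> vw vw' e0 es.
have eb p : bit w p = bit w' p by rewrite !step_bit // es.
apply: bword_ext => // ; elim=> [//|p IH]; apply: val_inj => /=.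
have := step_red p vw; have := step_red p vw'; rewrite es IH => ->.
move=> /(congr1 (modn^~ m)); rewrite ![_ + _ * m]addnC !modnMDl !modn_small //.
Qed.

Lemma step_modT w p : step w (p %% T.+1) = step w p.
Proof.
by rewrite /step bit_modT ltr_modT -addn1 -ltr_modT modnDml ltr_modT addn1.
Qed.

Lemma step_shift c w p : step ((shift ^+ c)%g w) p = step w (p + c).
Proof. by rewrite /step !ltr_shift bit_shift. Qed.

Lemma step_wrot r i w p : step ((wrot r ^+ i)%g w) p = step w p.
Proof.
have m0 : 0 < m by apply: leq_ltn_trans (ltn_ord (ltr w p)).
rewrite /step bit_wrot; congr (_ + _); rewrite !ltr_wrot modnDml.
have := divn_eq (ltr w p + i * r) m; have := ltn_pmod (ltr w p + i * r) m0.
have := ltn_ord (ltr w p); set z := _ %% m; set c := _ %/ m => ltx ltz e.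
have -> : ltr w p.+1 + i * r + (m - z) = c * m + (ltr w p.+1 + (m - ltr w p)) by lia.
by rewrite modnMDl.
Qed.

Lemma valid_shift c w : valid w -> valid ((shift ^+ c)%g w).
Proof.
by move=> /validP vw; apply/validP => p; rewrite bit_shift !ltr_shift addSn => /vw.
Qed.

Lemma valid_wrot r i w : valid w -> valid ((wrot r ^+ i)%g w).
Proof.
move=> /validP vw; apply/validP => p; rewrite bit_wrot => /vw e.
by apply: val_inj; rewrite /= !ltr_wrot e.
Qed.

Definition step_periodic w l : bool := [forall p : 'I_T.+1, step w (p + l) == step w p].

Lemma step_periodicP w l : reflect (forall p, step w (p + l) = step w p) (step_periodic w l).
Proof.
apply: (iffP forallP) => H p; last by rewrite H.
have /eqP := H (inZp p); rewrite /= step_modT => <-.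
by rewrite -step_modT -[RHS]step_modT modnDml.
Qed.

Lemma step_periodic_mul w l c : step_periodic w l -> step_periodic w (l * c).
Proof.
move/step_periodicP => H; apply/step_periodicP => p.
by elim: c => [|c IH]; rewrite ?muln0 ?addn0 // mulnS addnCA addnC H.
Qed.

Lemma step_periodic_sub w a b : step_periodic w (a + b) -> step_periodic w a ->
  step_periodic w b.
Proof.
move=> /step_periodicP Hab /step_periodicP Ha; apply/step_periodicP => p.
by rewrite -Ha -addnA [b + a]addnC Hab.
Qed.

Lemma step_periodic_gcd w a b : 0 < a -> step_periodic w a -> step_periodic w b ->
  step_periodic w (gcdn a b).
Proof.
move=> a0 Ha Hb; case: (egcdnP b a0) => x y e _.
apply: (@step_periodic_sub _ (y * b)); last by rewrite mulnC step_periodic_mul.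
by rewrite -e mulnC step_periodic_mul.
Qed.

Lemma step_periodic_shift w k : (shift ^+ k)%g w = w -> step_periodic w k.
Proof. by move=> e; apply/step_periodicP => p; rewrite -step_shift e. Qed.

End Words.

(** * Periods of words, and when a rotation of a word is one of its shifts *)

Section PeriodicWords.

Variables (m T : nat).
Local Notation word := (bword m T).
Local Notation shift := (shift m T).
Local Notation wrot := (@wrot m T).
Implicit Types (w : word) (p q k l : nat).

Definition period w : nat := #|porbit shift w|.

Lemma period_gt0 w : 0 < period w.
Proof. by apply/card_gt0P; exists w; apply: porbit_id. Qed.

Lemma shift_period w c : ((shift ^+ c)%g w == w) = (period w %| c).
Proof.
exact: perm_exp_fix.
Qed.

Lemma period_dvdT w : period w %| T.+1.
Proof. by rewrite -shift_period shiftT perm1. Qed.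

Lemma shift_stepP w k : valid w -> (shift ^+ k)%g w = w ->
  \sum_(p < k) step w p = redn w k * m.
Proof.
move=> vw e; have := sum_step k vw.
by rewrite -[in X in _ = X + _](add0n k) -ltr_shift e => /addnI.
Qed.

Lemma sum_periodic (F : nat -> nat) k c : (forall p, F (p + k) = F p) ->
  \sum_(p < k * c) F p = c * \sum_(p < k) F p.
Proof.
move=> per; have perc a p : F (k * a + p) = F p.
  by elim: a => [|a IH]; rewrite ?muln0 // mulnS -addnA addnC per.
elim: c => [|c IH]; first by rewrite muln0 big_ord0.
rewrite mulnS addnC big_split_ord /= IH mulSn addnC; congr (_ + _).
by apply: eq_bigr => p _; rewrite perc.
Qed.

Lemma redn_mul w k c : (shift ^+ k)%g w = w -> redn w (k * c) = c * redn w k.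
Proof.
move=> e; apply: (@sum_periodic (fun p => nat_of_bool (red w p))) => p.
by rewrite /red -addSn -!ltr_shift -bit_shift e.
Qed.

(* The displacement of [w] over [c] steps is [c * j * m / k], so [w] can agree with a
   rotation of one of its shifts only when its steps have the matching period. *)
Lemma wrot_in_porbit (d M : nat) w i : 0 < d -> m = d * M -> valid w ->
  ((wrot M ^+ i)%g w \in porbit shift w)
    = (d %| i * period w) && step_periodic w (i * period w %/ d).
Proof.
move=> d0 mE vw; have m0 : 0 < m by apply: leq_ltn_trans (ltn_ord (ltr w 0)).
have M0 : 0 < M by move: m0; rewrite mE muln_gt0 => /andP[].
set k := period w; have k0 : 0 < k := period_gt0 w.
have ek : (shift ^+ k)%g w = w by apply/eqP; rewrite shift_period.
have spk : step_periodic w k := step_periodic_shift ek.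
pose j := redn w k.
have sumk : \sum_(p < k) step w p = j * m := shift_stepP vw ek.
have sumc c : step_periodic w c -> k * \sum_(p < c) step w p = c * (j * m).
  move=> /step_periodicP pc; rewrite -sumk -(sum_periodic k pc) mulnC.
  by rewrite (sum_periodic c (elimT (step_periodicP w k) spk)).
apply/idP/andP => [/porbitP[c e]|[dvd pl]].
  have pc : step_periodic w c.
    by apply/step_periodicP => p; rewrite -step_shift -e step_wrot.
  have := sum_step c vw; set D := \sum_(p < c) _ => eD.
  have : ltr w 0 + D = ltr w 0 + i * M %[mod m].
    by rewrite eD addnC modnMDl -[X in ltr w X]add0n -ltr_shift -e ltr_wrot modn_mod.
  move/eqP; rewrite eqn_modDl => /eqP eDm.
  have [y1 [y2 ey]] : exists y1 y2, D + y1 * m = i * M + y2 * m.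
    exists (i * M %/ m), (D %/ m).
    by rewrite {1}(divn_eq D m) {2}(divn_eq (i * M) m) eDm; lia.
  (* Multiplying the displacement congruence by k and cancelling M shows i k / d to be an integer
     combination of the step periods c and k, written here without subtraction. *)
  have key : c * j * d + k * y1 * d = k * i + k * y2 * d.
    have := sumc c pc; rewrite -/D => e2.
    apply/eqP; rewrite -(eqn_pmul2r M0); apply/eqP.
    by have := congr1 (muln k) ey; rewrite mulnDr e2 mE; lia.
  have dvd : d %| i * k.
    rewrite mulnC -(@dvdn_addl (k * y2 * d)) ?dvdn_mull //.
    by rewrite -key dvdn_add // dvdn_mull.
  split=> //; have {}key : c * j + k * y1 = i * k %/ d + k * y2.
    by apply/eqP; rewrite -(eqn_pmul2r d0) !mulnDl divnK // key [i * k]mulnC.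
  apply: (@step_periodic_sub _ _ _ (k * y2)); last exact: step_periodic_mul.
  rewrite addnC -key; apply/step_periodicP => p.
  have /step_periodicP H1 := step_periodic_mul y1 spk.
  have /step_periodicP H2 := step_periodic_mul j pc.
  by rewrite addnA H1 H2.
set l := i * k %/ d in pl; have le : l * d = i * k by rewrite divnK.
pose h := gcdn k l; have ph : step_periodic w h by apply: step_periodic_gcd.
have h0 : 0 < h by rewrite gcdn_gt0 k0.
pose r := k %/ h; have kE : k = h * r by rewrite mulnC divnK // dvdn_gcdl.
have r0 : 0 < r by move: k0; rewrite kE muln_gt0 => /andP[].
pose l' := l %/ h; have lE : l = h * l' by rewrite mulnC divnK // dvdn_gcdr.
have cop : coprime r l'.
  by rewrite /coprime -(eqn_pmul2l h0) muln_gcdr -kE -lE muln1.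
have el : l' * d = i * r.
  by apply/eqP; rewrite -(eqn_pmul2l h0) mulnA -lE le kE; apply/eqP; lia.
(* If f divides both j and r, then k / f is a step period with displacement (j / f) m. The shift by
   k / f then fixes [w], and minimality of the period k forces f = 1. *)
have cop_j : coprime j r.
  rewrite /coprime; set f := gcdn j r.
  have f0 : 0 < f by rewrite gcdn_gt0 r0 orbT.
  have fr : f %| r := dvdn_gcdr _ _; have fj : f %| j := dvdn_gcdl _ _.
  have pc : step_periodic w (h * (r %/ f)) by apply: step_periodic_mul.
  have : period w %| h * (r %/ f).
    rewrite -shift_period; apply/eqP; apply: valid_ext => //.
    - exact: valid_shift.
    - have := sumc _ pc; set c := h * _; set D := \sum_(p < c) _ => eD.
      have eD' : D = (j %/ f) * m.
        apply/eqP; rewrite -(eqn_pmul2l k0) eD /c kE.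
        have := divnK fr; have := divnK fj; set rr := r %/ f; set jj := j %/ f => <- <-.
        by apply/eqP; lia.
      have := sum_step c vw; rewrite -/D eD' => e.
      apply: val_inj; rewrite /= ltr_shift add0n.
      have := congr1 (modn^~ m) e; rewrite ![_ + _ * m]addnC !modnMDl !modn_small //.
    - by move=> p; rewrite step_shift; apply: (elimT (step_periodicP _ _) pc).
  rewrite -/k kE dvdn_pmul2l // => /dvdn_leq; rewrite divn_gt0 // => /(_ (dvdn_leq r0 fr)).
  move=> le1; rewrite eqn_leq f0 andbT -(leq_pmul2l r0) muln1.
  by rewrite -{2}(divnK fr) leq_pmul2r.
have [x [y [z exy]]] : exists x y z, x * j + z * r = 1 + y * r.
  case: (posnP j) => [j0|jpos]; last first.
    case: (egcdnP r jpos) => x y; rewrite (eqP cop_j) addnC => e _.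
    by exists x, y, 0; rewrite addn0.
  have r1 : r = 1 by move: cop_j; rewrite j0 /coprime gcd0n => /eqP.
  by exists 0, 0, 1; rewrite r1.
(* Here x inverts j modulo r. The displacement over l x steps is l' x j m / r and the rotation is by
   i M = l' m / r, so the two agree modulo m. *)
apply/porbitP; exists (l * x).
have plx : step_periodic w (l * x) := step_periodic_mul x pl.
apply: valid_ext; [exact: valid_wrot | exact: valid_shift | | move=> p].
  apply: val_inj; rewrite /= ltr_wrot ltr_shift add0n.
  have := sum_step (l * x) vw; have := sumc _ plx; set D := \sum_(p < _) _ => e1 e2.
  have eD : D + (l' * z) * m = i * M + (l' * y) * m.
    have e3 : r * D = l' * x * j * m.
      by apply/eqP; rewrite -(eqn_pmul2l h0) mulnA -kE e1 lE; apply/eqP; lia.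
    apply/eqP; rewrite -(eqn_pmul2l r0) !mulnDr e3; apply/eqP.
    have -> : l' * x * j * m + r * (l' * z * m) = l' * m * (x * j + z * r) by lia.
    by rewrite exy mE; have := congr1 (muln^~ M) el => /=; lia.
  have := congr1 (fun s => (s + l' * z * m) %% m) e2.
  rewrite /= -addnA eD addnA ![_ + _ * m]addnC !modnMDl => ->.
  by rewrite modn_small.
by rewrite step_wrot step_shift (elimT (step_periodicP _ _) plx).
Qed.

End PeriodicWords.

(** * Periodic words parametrized by a starting letter and steps *)

Section Parametrization.

Variables (m T l : nat).
Hypothesis lT : l.+1 %| T.+1.
Local Notation word := (bword m T).
Local Notation shift := (shift m T).
Implicit Types (w : word) (p q k : nat) (v : {ffun 'I_l.+1 -> 'I_m.+1}).

Definition psum v p : nat := \sum_(q < p) v (inZp q).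

Lemma psumD v k c p : l.+1 %| k -> psum v (k * c + p) = c * psum v k + psum v p.
Proof.
move=> /dvdnP[k' ek].
have per q : v (inZp (q + k)) = v (inZp q) :> nat.
  by congr (nat_of_ord (v _)); apply: val_inj; rewrite /= ek addnC modnMDl.
rewrite /psum big_split_ord /=.
rewrite (sum_periodic c (F := fun q => v (inZp q))) //; congr (_ + _).
apply: eq_bigr => q _; elim: c => [|c IH]; first by rewrite muln0.
by rewrite mulnS -addnA addnC per IH.
Qed.

(** The walk from [u.1] with the steps [u.2] repeated periodically. It closes up only if the total
    displacement over [T.+1] steps is a multiple of [m], which is the condition [closed] below. *)
Definition word_of_steps (u : 'I_m * {ffun 'I_l.+1 -> 'I_m.+1}) : word :=
  [ffun p : 'I_T.+1 => (rot_ltr (psum u.2 p) u.1, u.2 (inZp p) == m :> nat)].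

Definition steps_of_word w : 'I_m * {ffun 'I_l.+1 -> 'I_m.+1} :=
  (ltr w 0, [ffun q : 'I_l.+1 => inord (step w q)]).

Section Closed.

Variables (a : 'I_m) (v : {ffun 'I_l.+1 -> 'I_m.+1}).
Hypothesis closed : m %| psum v T.+1.
Local Notation w := (word_of_steps (a, v)).

Lemma ltr_word_of_steps p : ltr w p = (a + psum v p) %% m :> nat.
Proof.
rewrite /ltr ffunE val_rot_ltr /= [in RHS](divn_eq p T.+1) [_ * T.+1]mulnC psumD //.
by case/dvdnP: closed => e ->; rewrite addnCA mulnA modnMDl.
Qed.

Lemma bit_word_of_steps p : bit w p = (v (inZp p) == m :> nat).
Proof.
rewrite /bit ffunE /=; congr (nat_of_ord (v _) == m); apply: val_inj => /=.
by rewrite modn_dvdm.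
Qed.

Lemma valid_word_of_steps : valid w.
Proof.
apply/validP => p; rewrite bit_word_of_steps => /eqP e; apply: val_inj => /=.
by rewrite !ltr_word_of_steps /psum big_ord_recr /= e addnA modnDr.
Qed.

Lemma step_word_of_steps p : step w p = v (inZp p).
Proof.
have m0 : 0 < m by apply: leq_ltn_trans (ltn_ord a).
rewrite /step bit_word_of_steps !ltr_word_of_steps /psum big_ord_recr /= addnA.
set s := a + _; have := ltn_ord (v (inZp p)); rewrite ltnS; set x := nat_of_ord (v _) => lex.
have -> : ((s + x) %% m + (m - s %% m)) %% m = x %% m.
  have := divn_eq s m; have := ltn_pmod s m0; set z := s %% m => ltz e.
  rewrite modnDml; have -> : s + x + (m - z) = (s %/ m).+1 * m + x by rewrite mulSn; lia.
  by rewrite modnMDl.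
move: lex; rewrite leq_eqVlt => /orP[/eqP ->|lt]; first by rewrite modnn eqxx mul1n.
by rewrite modn_small // ltn_eqF // addn0.
Qed.

Lemma word_of_stepsK : steps_of_word w = (a, v).
Proof.
congr pair; first by apply: val_inj; rewrite /= ltr_word_of_steps /psum big_ord0 addn0 modn_small.
apply/ffunP => q; rewrite ffunE step_word_of_steps; apply: val_inj.
rewrite /= inordK //; congr (nat_of_ord (v _)).
by apply: val_inj; rewrite /= modn_small.
Qed.

End Closed.

Lemma steps_of_wordK w : valid w -> step_periodic w l.+1 ->
  m %| psum (steps_of_word w).2 T.+1 /\ word_of_steps (steps_of_word w) = w.
Proof.
move=> vw pw.
have E p : (steps_of_word w).2 (inZp p) = step w p :> nat.
  rewrite ffunE inordK /=; last by rewrite ltnS step_le.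
  have /step_periodicP H := step_periodic_mul (p %/ l.+1) pw.
  by rewrite {2}(divn_eq p l.+1) addnC mulnC H.
have cl : m %| psum (steps_of_word w).2 T.+1.
  rewrite /psum (eq_bigr (fun q : 'I_T.+1 => step w q)) // (shift_stepP vw) ?dvdn_mull //.
  by rewrite shiftT perm1.
split=> //; apply: valid_ext => //.
- exact: (valid_word_of_steps (steps_of_word w).1 cl).
- apply: val_inj; rewrite /= (ltr_word_of_steps (steps_of_word w).1 cl).
  by rewrite /psum big_ord0 addn0 modn_small.
- by move=> p; rewrite (step_word_of_steps (steps_of_word w).1 cl) E.
Qed.

Variable (k : nat).
Hypotheses (lk : l.+1 %| k) (kT : k %| T.+1).

Lemma closed_psum v j : 0 < k -> psum v k = j * m -> m %| psum v T.+1.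
Proof.
move=> k0 e; have [c ->] := dvdnP kT.
by rewrite mulnC -[k * c]addn0 psumD // e /psum big_ord0 addn0 mulnA dvdn_mull.
Qed.

Lemma shift_word_of_steps a v j : 0 < k -> psum v k = j * m ->
  let w := word_of_steps (a, v) in
  [/\ valid w, (shift ^+ k)%g w = w, redn w k = j & step_periodic w l.+1].
Proof.
move=> k0 e w; have cl := closed_psum k0 e.
have vw : valid w := valid_word_of_steps a cl.
have pw : step_periodic w l.+1.
  apply/step_periodicP => p; rewrite !step_word_of_steps //; congr (nat_of_ord (v _)).
  by apply: val_inj; rewrite /= modnDr.
have m0 : 0 < m by apply: leq_ltn_trans (ltn_ord a).
have ek : (shift ^+ k)%g w = w.
  apply: valid_ext => //; first exact: valid_shift.
    apply: val_inj; rewrite /= ltr_shift add0n !ltr_word_of_steps // e.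
    by rewrite /psum big_ord0 addn0 addnC modnMDl.
  have [c ->] := dvdnP lk; rewrite mulnC => p; rewrite step_shift.
  exact: (elimT (step_periodicP _ _) (step_periodic_mul c pw)).
split=> //; apply/eqP; rewrite -(eqn_pmul2r m0) -(shift_stepP vw ek) -e; apply/eqP.
by apply: eq_bigr => q _; rewrite step_word_of_steps.
Qed.

Local Open Scope ring_scope.

(** Being fixed by the shift and having winding number [j] become one linear condition on the steps,
    while the starting letter is free. *)
Lemma sum_periodic_words (C : nmodType) (F : word -> C) (j : nat) : (0 < k)%N ->
  \sum_(w | [&& valid w, (shift ^+ k)%g w == w, redn w k == j & step_periodic w l.+1]) F w
  = \sum_a \sum_(v | psum v k == (j * m)%N) F (word_of_steps (a, v)).
Proof.
move=> k0; rewrite pair_big /=.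
rewrite (reindex_onto word_of_steps steps_of_word) => [|w /and4P[vw _ _ pw]]; last first.
  by have [] := steps_of_wordK vw pw.
apply: eq_big => [[a v]|[a v] _] //=; apply/andP/eqP => [[/and4P[vw /eqP ek /eqP ej pw] /eqP e]|e].
  rewrite -ej -(shift_stepP vw ek).
  have [cl _] := steps_of_wordK vw pw; rewrite e /= in cl.
  by apply: eq_bigr => q _; rewrite step_word_of_steps.
have [-> -> -> ->] := shift_word_of_steps a k0 e; rewrite !eqxx.
by rewrite word_of_stepsK //; apply: closed_psum e.
Qed.

End Parametrization.

(** * Closed walks weighted by a root of unity *)

Section GeometricSums.

Local Open Scope ring_scope.

Lemma prod_rev (R : comPzRingType) (F : nat -> R) k :
  \prod_(q < k) F (k - q.+1)%N = \prod_(q < k) F q.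
Proof. by rewrite [RHS](reindex_inj rev_ord_inj). Qed.

Lemma prod_periodic (R : comPzRingType) (F : nat -> R) D c :
  (forall q, F (D + q)%N = F q) -> \prod_(q < c * D) F q = (\prod_(q < D) F q) ^+ c.
Proof.
move=> per; elim: c => [|c IH]; first by rewrite mul0n big_ord0 expr0.
rewrite mulSn big_split_ord /= exprS -IH; congr (_ * _).
by apply: eq_bigr => q _; rewrite per.
Qed.


Variable (C : fieldType).

Definition geom (m e : nat) : {poly C} := \sum_(t < m.+1) 'X^(e * t).

(** Each step contributes an independent geometric sum; [e] is the number of times a step is
    repeated, and [J] the total displacement. *)
Lemma sum_bounded (m l J e : nat) (c : 'I_l -> C) :
  \sum_(v : {ffun 'I_l -> 'I_m.+1} | (e * \sum_q v q == J)%N) \prod_q c q ^+ v q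
    = (\prod_(q < l) \sum_(t < m.+1) c q ^+ t *: 'X^(e * t))`_J.
Proof.
rewrite bigA_distr_bigA coef_sum big_mkcond; apply: eq_bigr => v _.
rewrite scaler_prod prodrXr /= big_distrr /= coefZ coefXn eq_sym mulrC.
by case: eqP; rewrite ?mul1r ?mul0r.
Qed.

Lemma geomE m e : (1 - 'X^e) * geom m e = 1 - 'X^(e * m.+1).
Proof.
rewrite /geom (eq_bigr (fun t : 'I_m.+1 => 'X^e ^+ t)) => [|t _]; last by rewrite exprM.
by rewrite -opprB mulNr -subrX1 opprB -exprM.
Qed.

(** Multiply by 1 - X^D, the product of the 1 - z^q X. Each geometric sum becomes 1 - z^q X^(m+1)
    because z^m = 1, and these factors multiply to 1 - X^(D (m+1)). *)
Lemma prod_geom_root (D m : nat) (z : C) : D.-primitive_root z -> (D %| m)%N ->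
  \prod_(q < D) (\sum_(t < m.+1) (z ^+ q) ^+ t *: 'X^(1 * t)) = geom m D.
Proof.
move=> pz Dm; have D0 := prim_order_gt0 pz.
have nz : 1 - 'X^D != 0 :> {poly C}.
  by rewrite -size_poly_eq0 -opprB size_polyN size_XnsubC.
apply: (mulfI nz); rewrite geomE -(prod_1_sub_unity_rootX pz) -big_split /=.
have -> : 'X^(D * m.+1) = 'X^D \Po 'X^(m.+1) :> {poly C} by rewrite comp_Xn_poly -exprM mulnC.
have -> : 1 - ('X^D \Po 'X^(m.+1)) = (1 - 'X^D) \Po 'X^(m.+1) :> {poly C}.
  by rewrite rmorphB rmorph1.
rewrite -(prod_1_sub_unity_rootX pz) rmorph_prod; apply: eq_bigr => q _ /=.
rewrite comp_polyB comp_polyZ comp_polyX comp_polyC.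
transitivity ((1 - z ^+ q *: 'X) * \sum_(t < m.+1) (z ^+ q *: 'X) ^+ t).
  by congr (_ * _); apply: eq_bigr => t _; rewrite mul1n exprZn.
rewrite -opprB mulNr -subrX1 opprB exprZn; congr (1 - _ *: _).
have zm : z ^+ m = 1 by apply/eqP; rewrite -(prim_order_dvd pz).
by rewrite exprS exprAC zm expr1n mulr1.
Qed.

Lemma sum_root_powers (d m e : nat) (w : C) : d.-primitive_root w -> (d %| m)%N ->
  \sum_(a < m) w ^+ (e * a) = if (d %| e)%N then m%:R else 0.
Proof.
move=> pw dm; have we : (w ^+ e == 1) = (d %| e)%N by rewrite -(prim_order_dvd pw).
rewrite -we (eq_bigr (fun a : 'I_m => (w ^+ e) ^+ a)) => [|a _]; last by rewrite exprM.
case: eqP => [->|/eqP ne].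
  by rewrite (eq_bigr (fun=> 1)) ?sumr_const ?card_ord // => i _; rewrite expr1n.
have : (w ^+ e - 1) * \sum_(a < m) (w ^+ e) ^+ a = 0.
  rewrite -subrX1 -exprM mulnC exprM.
  by have [c ->] := dvdnP dm; rewrite mulnC exprM (prim_expr_order pw) !expr1n subrr.
by move/eqP; rewrite mulf_eq0 subr_eq0 (negPf ne) => /eqP.
Qed.

End GeometricSums.

(** * Weighted sums over words fixed by a shift *)

Section RootOfUnitySums.

Local Open Scope ring_scope.

Variables (C : fieldType) (d m T : nat) (w : C).
Hypotheses (pw : d.-primitive_root w) (dm : (d %| m)%N).
Local Notation word := (bword m T).
Local Notation shift := (shift m T).

Definition wt (x : word) (k : nat) : nat := (\sum_(p < k) ltr x p)%N.

(** In a walk from [a], the step at q affects precisely the k - q - 1 later letters among the first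
    k. *)
Lemma sum_partial_sums (F : nat -> nat) (a k : nat) :
  (\sum_(p < k) (a + \sum_(q < p) F q) = k * a + \sum_(q < k) (k - q.+1) * F q)%N.
Proof.
elim: k => [|k IH]; first by rewrite !big_ord0.
rewrite !big_ord_recr /= IH subnn mul0n addn0 mulSn.
rewrite addnACA [(k * a + a)%N]addnC; congr (_ + _)%N; rewrite -big_split /=; apply: eq_bigr => q _.
by have := ltn_ord q => lt; rewrite -mulSnr; congr (_ * _)%N; lia.
Qed.

Lemma root_modm a b : (a = b %[mod m])%N -> w ^+ a = w ^+ b.
Proof.
move=> e; apply/eqP; rewrite (eq_prim_root_expr pw).
by rewrite -(modn_dvdm a dm) -(modn_dvdm b dm) e.
Qed.

(* The starting point contributes [m] or [0]; the steps contribute a product of geometric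
   sums, equal by [prod_geom_root] to the generating function of the periodic steps. *)
Lemma sum_fixed_words (k i j : nat) : (0 < k)%N -> (k %| T.+1)%N ->
  \sum_(x : word | [&& valid x, (shift ^+ k)%g x == x & redn x k == j]) w ^+ (i * wt x k)
  = #|[set x : word | [&& valid x, (shift ^+ k)%g x == x, redn x k == j
          & (d %| i * k)%N && step_periodic x (i * k %/ d)%N]]|%:R.
Proof.
move=> k0 kT; have d0 := prim_order_gt0 pw.
have [n kS] : exists n, k = n.+1 by exists k.-1; rewrite prednK.
have kk : (n.+1 %| k)%N by rewrite -kS.
have -> : \sum_(x : word | [&& valid x, (shift ^+ k)%g x == x & redn x k == j]) w ^+ (i * wt x k)
  = \sum_(x : word | [&& valid x, (shift ^+ k)%g x == x, redn x k == j & step_periodic x n.+1])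
      w ^+ (i * wt x k).
  apply: eq_bigl => x; case: (valid x) => //=; case: eqP => //= /step_periodic_shift.
  by rewrite -kS => ->; rewrite andbT.
have nT : (n.+1 %| T.+1)%N by rewrite -kS.
rewrite (sum_periodic_words nT kk kT) //.
(* As d divides m, the exponent may use unreduced partial sums in place of letters; the start and
   the steps then separate. *)
transitivity (\sum_(a < m) w ^+ (i * k * a) *
   \sum_(v : {ffun 'I_n.+1 -> 'I_m.+1} | (1 * \sum_q v q == j * m)%N)
      \prod_(q < n.+1) (w ^+ i ^+ (k - q.+1)) ^+ v q).
  apply: eq_bigr => a _; rewrite mulr_sumr.
  have psE v : psum v k = (\sum_(q < n.+1) v q)%N :> nat.
    rewrite /psum kS; apply: eq_bigr => q _; congr (nat_of_ord (v _)).
    by apply: val_inj; rewrite /= modn_small.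
  apply: eq_big => [v|v /eqP e]; first by rewrite psE mul1n.
  have cl := closed_psum kk kT k0 e.
  rewrite (_ : \prod_(q < n.+1) _ = w ^+ (i * \sum_(q < k) (k - q.+1) * v (inZp q))); last first.
    rewrite kS big_distrr /= -prodrXr; apply: eq_bigr => q _.
    rewrite -!exprM; congr (w ^+ _); congr (_ * (_ * nat_of_ord (v _)))%N.
    by apply: val_inj; rewrite /= modn_small.
  rewrite -exprD; apply: root_modm.
  rewrite -mulnA -mulnDr -(sum_partial_sums (fun q => v (inZp q))) /wt.
  rewrite -modnMmr -[RHS]modnMmr; congr (_ * _ %% m)%N; rewrite -modn_summ -[RHS]modn_summ.
  by congr (_ %% m)%N; apply: eq_bigr => p _; rewrite ltr_word_of_steps // modn_mod.
rewrite -mulr_suml (sum_root_powers _ pw dm).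
case: ifP => [dik|ndik]; last first.
  rewrite mul0r (_ : [set x | _] = set0) ?cards0 //.
  by apply/setP => x; rewrite !inE !andbF.
rewrite sum_bounded.
(* D is the order of [w ^+ i]. With k = k' D and i = g i' one gets i k / d = k' i' with D and i'
   coprime. For a word of step period k, having step period i k / d therefore means having step
   period k'. *)
pose D := (d %/ gcdn i d)%N.
have pz : D.-primitive_root (w ^+ i) := exp_prim_root pw i.
have D0 : (0 < D)%N := prim_order_gt0 pz.
have Dd : (D %| d)%N by apply: dvdn_div; apply: dvdn_gcdr.
pose g := gcdn i d; have g0 : (0 < g)%N by rewrite gcdn_gt0 d0 orbT.
pose i' := (i %/ g)%N.
have dE : d = (g * D)%N by rewrite mulnC divnK // dvdn_gcdr.
have iE : i = (g * i')%N by rewrite mulnC divnK // dvdn_gcdl.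
have cop : coprime D i'.
  by rewrite /coprime -(eqn_pmul2l g0) muln_gcdr -dE -iE muln1 gcdnC.
have Dk : (D %| k)%N.
  by move: dik; rewrite {1}dE iE -mulnA dvdn_pmul2l // Gauss_dvdr.
have [k' ek] := dvdnP Dk.
have k'0 : (0 < k')%N by move: k0; rewrite ek muln_gt0 => /andP[].
have [n' n'S] : exists n', k' = n'.+1 by exists k'.-1; rewrite prednK.
have lE : (i * k %/ d = k' * i')%N.
  rewrite dE {1}iE ek (_ : (g * i' * (k' * D) = k' * i' * (g * D))%N) ?mulnK ?muln_gt0 ?g0 //.
  by lia.
have n'k : (n'.+1 %| k)%N by rewrite -n'S ek dvdn_mulr.
have n'T : (n'.+1 %| T.+1)%N by apply: dvdn_trans n'k kT.
have -> : [set x : word | [&& valid x, (shift ^+ k)%g x == x, redn x k == j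
          & true && step_periodic x (i * k %/ d)%N]]
  = [set x : word | [&& valid x, (shift ^+ k)%g x == x, redn x k == j & step_periodic x n'.+1]].
  apply/setP => x; rewrite !inE; case: (valid x) => //=; case: eqP => //= /step_periodic_shift pk.
  congr (_ && _); rewrite lE -n'S; apply/idP/idP => [pl|]; last exact: step_periodic_mul.
  have := step_periodic_gcd k0 pk pl.
  by rewrite ek -muln_gcdr (eqP cop) muln1.
rewrite -sum1_card natr_sum (eq_bigl _ _ (fun x => in_set _ x)).
rewrite (sum_periodic_words n'T n'k kT) //.
rewrite sumr_const card_ord mulr_natl; congr (_ *+ m).
have -> : \sum_(v : {ffun 'I_n'.+1 -> 'I_m.+1} | psum v k == (j * m)%N) 1 =
  \sum_(v : {ffun 'I_n'.+1 -> 'I_m.+1} | (D * \sum_q v q == j * m)%N) \prod_(q < n'.+1) (1 ^+ v q) :> C.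
  apply: eq_big => [v|v _]; last by rewrite big1 // => q _; rewrite expr1n.
  rewrite ek -[(k' * D)%N]addn0 psumD -?n'S // [X in (_ + X)%N]/psum big_ord0 addn0.
  congr (_ * _ == _)%N; rewrite /psum n'S; apply: eq_bigr => q _; congr (nat_of_ord (v _)).
  by apply: val_inj; rewrite /= modn_small.
rewrite (sum_bounded m (j * m) D (fun _ : 'I_n'.+1 => 1)); congr (_`_ _).
transitivity (geom C m D ^+ n'.+1); last first.
  rewrite prodr_const card_ord; under [in RHS]eq_bigr do rewrite expr1n scale1r.
  by [].
(* The weighted factors depend only on q modulo D, so the k of them form k' blocks, each equal to
   the generating function of one step repeated D times. *)
rewrite -(prod_geom_root pz); last by apply: dvdn_trans dm.
pose F (q : nat) : {poly C} := \sum_(t < m.+1) w ^+ i ^+ q ^+ t *: 'X^(1 * t).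
have perF q : F (D + q)%N = F q.
  by rewrite /F exprD (prim_expr_order pz) mul1r.
transitivity (\prod_(q < k) F q); first by rewrite -prod_rev kS.
by rewrite ek n'S (prod_periodic _ perF).
Qed.

End RootOfUnitySums.

(** * From words fixed by a shift to words of exact period *)

Section PeriodClasses.

Local Open Scope ring_scope.

Variables (C : fieldType) (d m T : nat) (w : C).
Hypotheses (pw : d.-primitive_root w) (dm : (d %| m)%N).
Local Notation word := (bword m T).
Local Notation shift := (shift m T).

Lemma wt_mul (x : word) k c : (shift ^+ k)%g x = x -> wt x (k * c) = (c * wt x k)%N.
Proof.
move=> e; apply: (@sum_periodic (fun p => nat_of_ord (ltr x p))) => p.
by rewrite -ltr_shift e.
Qed.

(** The weight minus the indicator that, for [k] the period of [x], the [i]-th power of the rotation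
    maps [x] to one of its shifts, as expressed by [wrot_in_porbit]. *)
Definition defect (i k : nat) (x : word) : C :=
  w ^+ (i * wt x k) - ((d %| i * k)%N && step_periodic x (i * k %/ d)%N)%:R.

Lemma sum_defect_fixed k i j : (0 < k)%N -> (k %| T.+1)%N ->
  \sum_(x : word | [&& valid x, (shift ^+ k)%g x == x & redn x k == j]) defect i k x = 0.
Proof.
move=> k0 kT; rewrite sumrB (sum_fixed_words pw dm) // -sum1_card natr_sum.
apply/eqP; rewrite subr_eq0; apply/eqP.
rewrite [LHS]big_mkcond [RHS]big_mkcond; apply: eq_bigr => x _; rewrite inE.
by case: (valid x); case: (_ == x); case: (_ == j) => //=; case: ifP => // /andP[-> ->].
Qed.

(** Viewed at length k, a word of period k' = k / c has the defect it has at length k' with [i]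
    replaced by i c, and its winding number is multiplied by c. Proper divisors of k thus drop out
    by induction from the sum over words fixed by the shift. *)
Lemma sum_defect_period k i j : (k %| T.+1)%N ->
  \sum_(x : word | [&& valid x, period x == k & redn x k == j]) defect i k x = 0.
Proof.
elim/ltn_ind: k i j => k IH i j kT.
have [->|k0] := posnP k.
  by rewrite big_pred0 // => x; rewrite eqn0Ngt period_gt0 andbF.
have := sum_defect_fixed i j k0 kT.
rewrite (partition_big (fun x => inord (period x) : 'I_k.+1) predT) //=.
rewrite (bigD1 ord_max) //= [X in _ + X]big1 ?addr0 => [E|k' nk'].
  rewrite -[RHS]E; apply: eq_bigl => x; rewrite shift_period.
  case: (valid x) => //=; rewrite -val_eqE /=.
  case: (boolP (period x %| k)%N) => /= [dvd|ndvd].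
    have lt : (period x < k.+1)%N by rewrite ltnS dvdn_leq.
    by rewrite (inordK lt) andbC.
  by apply: contraNF ndvd => /andP[/eqP ->].
have [k'k|nk'k] := boolP (k' %| k)%N; last first.
  rewrite big_pred0 // => x; apply: contraNF nk'k => /andP[/and3P[_]].
  rewrite shift_period => dvd _ /eqP <-.
  have lt : (period x < k.+1)%N by rewrite ltnS dvdn_leq.
  by rewrite (inordK lt).
have [c ek] := dvdnP k'k.
have c0 : (0 < c)%N by move: k0; rewrite ek muln_gt0 => /andP[].
have lt' : (k' < k)%N.
  rewrite ltn_neqAle -ltnS ltn_ord andbT; apply: contraNneq nk' => e.
  by apply/eqP/val_inj.
have fixE (x : word) : period x = k' -> (shift ^+ k')%g x = x.
  by move=> e'; apply/eqP; rewrite shift_period e'.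
have rE (x : word) : period x = k' -> redn x k = (c * redn x k')%N.
  by move=> e'; rewrite -redn_mul ?fixE // mulnC -ek.
have P (x : word) : [&& valid x, (shift ^+ k)%g x == x & redn x k == j] && (inord (period x) == k')
   = [&& valid x, period x == k' & c * redn x k' == j]%N.
  case: (valid x) => //=; rewrite shift_period; apply/idP/idP.
    move=> /andP[/andP[dvd rj] /eqP e].
    have lt : (period x < k.+1)%N by rewrite ltnS dvdn_leq.
    have e' : period x = k' by rewrite -e (inordK lt).
    by rewrite e' eqxx /= -rE.
  move=> /andP[/eqP e' rj]; rewrite e' k'k rE ?rj //=.
  by apply/eqP/val_inj; rewrite /= inordK.
rewrite (eq_bigl _ _ P).
have [cj|ncj] := boolP (c %| j)%N; last first.
  rewrite big_pred0 // => x; apply: contraNF ncj => /and3P[_ _ /eqP <-].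
  exact: dvdn_mulr.
have [j' ej] := dvdnP cj.
rewrite -[RHS](IH k' lt' (i * c)%N j' (dvdn_trans k'k kT)).
apply: eq_big => [x|x /and3P[_ /eqP e' _]].
  by rewrite ej [(j' * c)%N]mulnC eqn_pmul2l.
have wE : wt x k = (c * wt x k')%N by rewrite -wt_mul ?fixE // mulnC -ek.
have iE : (i * k = i * c * k')%N by rewrite {1}ek mulnA.
by rewrite /defect wE iE mulnA.
Qed.

End PeriodClasses.

(** * Rotating a bicolored word *)

Section Rotation.

Local Open Scope ring_scope.

Variables (C : numFieldType) (d M m T : nat) (w : C).
Hypotheses (pw : d.-primitive_root w) (mE : m = (d * M)%N).
Local Notation word := (bword m T).
Local Notation shift := (shift m T).
Local Notation rot := (@wrot m T M).
Implicit Types (x y : word).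

Let rs : commute rot shift := @wrot_shift m T M.

Definition all_bits (x : word) : bool := [forall p : 'I_T.+1, bit x p].

Lemma all_bitsP x : reflect (forall p, bit x p) (all_bits x).
Proof. by apply: (iffP forallP) => // H p; have := H (inZp p); rewrite /= bit_modT. Qed.

(* A necklace consisting of a single red letter is forbidden, and so are its powers. *)
Definition word_set : {set word} := [set x : word | valid x && ~~ all_bits x].

Lemma period_wrot i x : period ((rot ^+ i)%g x) = period x.
Proof.
rewrite /period -(porbit_perm_image (s := shift)) ?card_imset //; first exact: perm_inj.
exact/commute_sym/commuteX/commute_sym/wrot_shift.
Qed.

Lemma period_shift i x : period ((shift ^+ i)%g x) = period x.
Proof. by rewrite /period porbit_perm. Qed.

Lemma redn_wrot i x : valid x -> redn ((rot ^+ i)%g x) (period x) = redn x (period x).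
Proof.
move=> vx; have m0 : (0 < m)%N by apply: leq_ltn_trans (ltn_ord (ltr x 0)).
have fx : (shift ^+ period x)%g x = x by apply/eqP; rewrite shift_period.
have fx' : (shift ^+ period x)%g ((rot ^+ i)%g x) = (rot ^+ i)%g x.
  by apply/eqP; rewrite shift_period period_wrot.
apply/eqP; rewrite -(eqn_pmul2r m0) -(shift_stepP (valid_wrot M i vx) fx') -(shift_stepP vx fx).
by apply/eqP; apply: eq_bigr => p _; rewrite step_wrot.
Qed.

(** Summed over a multiset, the coefficient of X^k for k > 0 counts the letters in necklaces of
    length k, and the constant coefficient counts red letters. Periods are positive, so the two do
    not mix. *)
Definition grade x : {poly int} := 'X^(period x) + (red x 0 : nat)%:R.

(** The total grade of a shift orbit of [k] words, [j] of which start with a red letter. *)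
Definition class_grade k j : {poly int} := 'X^k *+ k + j%:R.

Lemma sum_grade_porbit x :
  \sum_(y in porbit shift x) grade y = class_grade (period x) (redn x (period x)).
Proof.
rewrite sum_porbit big_split /=; congr (_ + _).
  by under eq_bigr do rewrite period_shift; rewrite sumr_const card_ord.
rewrite /redn natr_sum; apply: eq_bigr => i _.
by rewrite /red !ltr_shift bit_shift add0n add1n.
Qed.

Lemma word_set_porbit x y : y \in porbit shift x -> x \in word_set -> y \in word_set.
Proof.
move=> yx; have := yx; rewrite porbit_sym => /porbitP[c ex]; case/porbitP: yx => c' ey.
rewrite !inE => /andP[vx nb]; rewrite {1}ey valid_shift //=.
by apply: contraNN nb => /all_bitsP ab; apply/all_bitsP => p; rewrite ex bit_shift.
Qed.

Lemma word_set_orbit2 x y : y \in orbit2 shift rot x -> x \in word_set -> y \in word_set.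
Proof.
case/(orbit2P rs) => c e; rewrite inE => /andP[vx nb].
apply: (@word_set_porbit ((rot ^+ c)%g x)); first by rewrite -e porbit_id.
rewrite inE valid_wrot //=; apply: contraNN nb => /all_bitsP ab.
by apply/all_bitsP => p; rewrite -(bit_wrot M c).
Qed.

(** The excluded words form one whole class of given period and number of red letters, so excluding
    them does not disturb the cancellation inside the other classes. *)
Lemma word_set_class x : valid x ->
  (x \in word_set) = ~~ ((period x == 1) && (redn x (period x) == 1))%N.
Proof.
move=> vx; rewrite inE vx /=; congr (~~ _); apply/idP/andP => [/all_bitsP ab|[/eqP p1]].
  have p1 : period x = 1%N.
    apply/eqP; rewrite -dvdn1 -shift_period; apply/eqP; apply: bword_ext => p.
      by rewrite ltr_shift addn1; apply: (elimT (validP x) vx).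
    by rewrite bit_shift !ab.
  by rewrite p1 /redn big_ord1 /red ab orbT.
have fx p : bit x p = bit x 0 /\ ltr x p = ltr x 0.
  have /eqP := shift_period x p; rewrite p1 dvd1n => /eqP/eqP e.
  by split; [rewrite -{2}e bit_shift | rewrite -{2}e ltr_shift].
rewrite p1 /redn big_ord1 /red (fx 1%N).2 ltnn /= => b0.
by apply/all_bitsP => p; rewrite (fx p).1; case: (bit x 0) b0.
Qed.

(** [Phi] stands for the remainder of the recursion, which sees a word only through its period and
    number of red letters; the defects cancel class by class. *)
Lemma sum_defect_class i (Phi : nat -> nat -> C) :
  \sum_(x in word_set) defect d w i (period x) x * Phi (period x) (redn x (period x)) = 0.
Proof.
have dm : (d %| m)%N by rewrite mE dvdn_mulr.
have le_period x : (period x <= T.+1)%N by rewrite dvdn_leq // period_dvdT.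
have le_redn x : (redn x (period x) <= T.+1)%N.
  apply: leq_trans (le_period x); rewrite /redn -[leqRHS]card_ord -sum1_card.
  by apply: leq_sum => p _; apply: leq_b1.
pose cls x : 'I_T.+2 * 'I_T.+2 := (inord (period x), inord (redn x (period x))).
rewrite (partition_big cls predT) //= big1 // => [[k j]] _.
have clsE x : (cls x == (k, j)) = (period x == k) && (redn x (period x) == j).
  by rewrite /cls xpair_eqE -!val_eqE /= !inordK // ltnS.
have E x : (x \in word_set) && (cls x == (k, j)) =
    (~~ ((k == 1 :> nat) && (j == 1 :> nat)) && [&& valid x, period x == k & redn x k == j])%N.
  rewrite clsE; case: (boolP (valid x)) => [vx|nvx]; last by rewrite inE (negPf nvx) /= andbF.
  rewrite word_set_class //=; case: (eqVneq (period x) k) => [->|_]; last by rewrite !andbF.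
  by case: (eqVneq (redn x k) j) => [->|_]; rewrite ?andbF.
rewrite (eq_bigl _ _ E).
transitivity (\sum_(x : word | ~~ ((k == 1 :> nat) && (j == 1 :> nat))%N &&
    [&& valid x, period x == k & redn x k == j]) defect d w i k x * Phi k j).
  by apply: eq_bigr => x /and4P[_ _ /eqP -> /eqP ->].
case: (~~ _) => /=; last by rewrite big_pred0.
rewrite -mulr_suml /=; case: (boolP (k %| T.+1)%N) => kT.
  by rewrite (sum_defect_period pw dm) // mul0r.
rewrite big_pred0 ?mul0r // => x; apply: contraNF kT => /and3P[_ /eqP <- _].
exact: period_dvdT.
Qed.

(** Removing i copies of an orbit made of o necklaces removes i o necklaces of one class, so the
    rotation side of the recursion runs over multiples of o. *)
Lemma sum_multiples (R : nmodType) (F : nat -> R) (K n o k : nat) : (0 < o)%N -> (0 < k)%N ->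
  (n <= K)%N ->
  \sum_(i < K.+1 | (0 < i)%N && (i * (o * k) <= n)%N) F (i * o)%N
    = \sum_(i < K.+1 | (0 < i)%N && [&& (o %| i)%N & (i * k <= n)%N]) F i.
Proof.
move=> o0 k0 nK.
have leK i : (i * k <= n)%N -> (i < K.+1)%N.
  by move=> h; rewrite ltnS (leq_trans _ (leq_trans h nK)) // leq_pmulr.
rewrite [RHS](reindex_onto (fun i : 'I_K.+1 => inord (i * o)) (fun i : 'I_K.+1 => inord (i %/ o))) /=.
  apply: eq_big => [i|i /andP[i0 le]].
    apply/andP/andP => [[i0 le]|[/and3P[i0 oi le] /eqP e]].
      have lt : (i * o < K.+1)%N by apply: leK; rewrite -mulnA.
      rewrite (inordK lt) muln_gt0 i0 o0 dvdn_mull //= -mulnA le; split=> //.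
      by rewrite mulnK // inord_val.
    have e' : (i = (inord (i * o) : 'I_K.+1) %/ o :> nat)%N.
      by rewrite -{1}e inordK // (leq_ltn_trans (leq_div _ _)).
    split; first by rewrite lt0n e' -lt0n divn_gt0 // dvdn_leq.
    by rewrite e' mulnA divnK.
  rewrite inordK //; apply: leK; by rewrite -mulnA.
move=> i /andP[i0 /andP[oi le]]; apply: val_inj.
by rewrite /= (inordK (leq_ltn_trans (leq_div i o) (ltn_ord i))) divnK ?inordK.
Qed.

Variable K : nat.

Lemma multiset_sum0 (O : word -> {set word}) (x1 : word -> C) v :
  multiset_sum O word_set K grade x1 0 v = (v == 0)%:R.
Proof.
rewrite /multiset_sum; pose N0 : {ffun word -> 'I_K.+1} := [ffun=> ord0].
have E N : invariant_multiset O word_set grade 0 v N = (N == N0) && (v == 0).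
  apply/invariant_multisetP/andP => [[_ _ /eqP s0 <-]|[/eqP-> /eqP->]].
    rewrite sum_nat_eq0 in s0.
    have e0 a : N a = 0%N :> nat by move/forallP/(_ a)/implyP/(_ isT)/eqP: s0.
    split; first by apply/eqP/ffunP => a; apply: val_inj; rewrite ffunE /= e0.
    by rewrite big1 // => a _; rewrite e0.
  split=> *; rewrite ?ffunE //; first by rewrite big1 // => a _; rewrite ffunE.
  by rewrite big1 // => a _; rewrite ffunE.
rewrite (eq_bigl _ _ E); case: eqP => _; last by rewrite big_pred0 // => N; rewrite andbF.
rewrite (big_pred1 N0) => [|N]; last by rewrite /= andbT.
by rewrite big1 // => a _; rewrite ffunE expr0.
Qed.

(** Once induction has identified the smaller sums, the two recursions differ only in a coefficient:
    a power of [w] on one side, the indicator that the orbit index divides i on the other. The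
    difference is [defect]. *)
Theorem multiset_sum_rotation n v : (n <= K)%N ->
  multiset_sum (porbit shift) word_set K grade (fun y => w ^+ ltr y 0) n v
    = multiset_sum (orbit2 shift rot) word_set K grade (fun=> 1) n v.
Proof.
have d0 := prim_order_gt0 pw.
elim/ltn_ind: n v => n IH v nK.
have [->|n0] := posnP n; first by rewrite !multiset_sum0.
have nz : n%:R != 0 :> C by rewrite pnatr_eq0 -lt0n.
apply: (mulfI nz).
rewrite newton_recursion //; first last.
- exact: word_set_porbit.
- by move=> a b; rewrite -eq_porbit_mem => /eqP.
- by move=> a; apply: porbit_id.
rewrite newton_recursion //; first last.
- exact: word_set_orbit2.
- exact: (orbit2_eq rs).
- exact: (orbit2_refl rs).
pose I2 := multiset_sum (orbit2 shift rot) word_set K grade (fun=> 1 : C).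
pose Phi i k j := if (i * k <= n)%N then I2 (n - i * k)%N (v - class_grade k j *+ i) else 0.
transitivity (\sum_(x in word_set) \sum_(i < K.+1 | (0 < i)%N)
   w ^+ (i * wt x (period x)) * Phi i (period x) (redn x (period x))).
  apply: eq_bigr => x xW; rewrite big_mkcondr /=; apply: eq_bigr => i i0.
  rewrite -/(period x) /Phi; case: ifP => le; last by rewrite mulr0.
  rewrite sum_grade_porbit IH; last first.
  - exact: leq_trans (leq_subr _ _) nK.
  - by rewrite ltn_subrL n0 muln_gt0 i0 period_gt0.
  congr (_ * _); rewrite mulnC exprM; congr (_ ^+ _); rewrite prodrXr; congr (_ ^+ _).
  rewrite (sum_porbit shift (fun y => nat_of_ord (ltr y 0))) /wt.
  by apply: eq_bigr => p _; rewrite ltr_shift.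
transitivity (\sum_(x in word_set) \sum_(i < K.+1 | (0 < i)%N)
   (orbit2_index shift rot x %| i)%N%:R * Phi i (period x) (redn x (period x))); last first.
  apply: eq_bigr => x xW; have vx : valid x by move: xW; rewrite inE => /andP[].
  pose o := orbit2_index shift rot x.
  have o0 : (0 < o)%N by apply/card_gt0P; exists (porbit shift x); apply: porbit_id.
  have cO : #|orbit2 shift rot x| = (o * period x)%N.
    rewrite -sum1_card (sum_orbit2 rs (c := period x)) => [|i].
      by rewrite -/o mulnC; elim: (o) => [|b IHb]; rewrite ?muln0 // mulrS IHb mulnS.
    by rewrite sum1_card -/(period _) period_wrot.
  have gO : \sum_(y in orbit2 shift rot x) grade y = class_grade (period x) (redn x (period x)) *+ o.
    apply: (sum_orbit2 rs) => i.
    by rewrite sum_grade_porbit period_wrot redn_wrot.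
  rewrite cO gO.
  transitivity (\sum_(i < K.+1 | (0 < i)%N && (i * (o * period x) <= n)%N)
     I2 (n - (i * o) * period x)%N (v - class_grade (period x) (redn x (period x)) *+ (i * o))).
    rewrite (sum_multiples (fun i => I2 (n - i * period x)%N (v - class_grade (period x) (redn x (period x)) *+ i))) ?period_gt0 //.
    rewrite [RHS]big_mkcondr /=; apply: eq_bigr => i _; rewrite -/o /Phi.
    by case: (o %| i)%N; rewrite ?mul1r ?mul0r.
  by apply: eq_bigr => i _; rewrite big1 // expr1n mul1r mulnA mulrnA mulrnAC.
rewrite exchange_big [RHS]exchange_big /=; apply: eq_bigr => i _.
apply/eqP; rewrite -subr_eq0 -sumrB; apply/eqP; rewrite -[RHS](sum_defect_class i (Phi i)).
apply: eq_bigr => x; rewrite inE => /andP[vx _].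
rewrite -mulrBl /defect (orbit2_index_dvd rs).
by rewrite (wrot_in_porbit i d0 mE vx).
Qed.

End Rotation.

(** * Standardization *)

Definition digits (B N : nat) (c : nat -> nat) : nat := \sum_(p < N) c p * B ^ (N - p.+1).

Lemma digitsSl B N c : digits B N.+1 c = c 0 * B ^ N + digits B N (c \o succn).
Proof. by rewrite /digits big_ord_recl subSS subn0. Qed.

Lemma digitsSr B N c : digits B N.+1 c = B * digits B N c + c N.
Proof.
rewrite /digits big_ord_recr subnn muln1 big_distrr /=; congr (_ + _).
by apply: eq_bigr => p _; rewrite subSn // expnS mulnCA.
Qed.

Lemma digits_lt B N c : (forall p, c p < B) -> digits B N c < B ^ N.
Proof.
move=> cB; elim: N c cB => [|N IH] c cB; first by rewrite /digits big_ord0.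
rewrite digitsSl expnS; have := IH (c \o succn) (fun p => cB p.+1).
by have := cB 0; nia.
Qed.

Section Keys.

Variables (m T : nat).
Local Notation word := (bword m T).
Local Notation shift := (shift m T).
Implicit Types (w : word) (p : nat).

(* Larger letters come first and, among equal letters, red comes before blue; [key] then
   orders words lexicographically. *)
Definition code w p : nat := 2 * (m - ltr w p) + ~~ red w p.

Definition key w : nat := digits (2 * m + 2) T.+1 (code w).

Lemma red_shift c w p : red ((shift ^+ c)%g w) p = red w (p + c).
Proof. by rewrite /red !ltr_shift bit_shift. Qed.

Lemma code_shift c w p : code ((shift ^+ c)%g w) p = code w (p + c).
Proof. by rewrite /code ltr_shift red_shift. Qed.

Lemma code_lt w p : code w p < 2 * m + 2.
Proof. by rewrite /code; case: (red w p) => /=; lia. Qed.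

Lemma key_code w : exists2 r, r < (2 * m + 2) ^ T & key w = code w 0 * (2 * m + 2) ^ T + r.
Proof.
exists (digits (2 * m + 2) T (code w \o succn)); last exact: digitsSl.
by apply: digits_lt => p; apply: code_lt.
Qed.

Lemma key_lt_code w w' : code w 0 < code w' 0 -> key w < key w'.
Proof.
have [r lr ->] := key_code w; have [r' _ ->] := key_code w'.
by move: ((2 * m + 2) ^ T) lr => b lr lc; have := leq_mul lc (leqnn b); lia.
Qed.

Lemma key_le_code w w' : key w <= key w' -> code w 0 <= code w' 0.
Proof. by rewrite leqNgt; apply: contraR; rewrite -ltnNge; apply: key_lt_code. Qed.

(** A cyclic shift moves the leading digit to the end; the identity is arranged to avoid
    subtraction. *)
Lemma key_shift w : key (shift w) + code w 0 * (2 * m + 2) ^ T.+1 = (2 * m + 2) * key w + code w 0.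
Proof.
rewrite addnC; have <- : digits (2 * m + 2) T.+2 (code w) = (2 * m + 2) * key w + code w 0.
  rewrite digitsSr; congr (_ + _).
  by have := code_shift T.+1 w 0; rewrite shiftT perm1 add0n => ->.
rewrite digitsSl; congr (_ + _); apply: eq_bigr => p _ /=.
by rewrite -[shift]expg1 code_shift addn1.
Qed.

Lemma key_shift_lt w w' : code w 0 = code w' 0 ->
  (key (shift w) < key (shift w')) = (key w < key w').
Proof.
move=> e; have k1 := key_shift w; have k2 := key_shift w'; rewrite e in k1.
have b0 : 0 < 2 * m + 2 by lia.
rewrite -[RHS](ltn_pmul2l b0) -[RHS](ltn_add2r (code w' 0)) -k1 -k2.
by rewrite ltn_add2r.
Qed.

Lemma key_shift_le w w' : code w 0 = code w' 0 ->
  (key (shift w) <= key (shift w')) = (key w <= key w').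
Proof. by move=> e; rewrite leqNgt key_shift_lt // -leqNgt. Qed.

Lemma bit_red w p : valid w -> bit w p = red w p && (ltr w p.+1 == ltr w p).
Proof.
move=> /validP/(_ p); rewrite /red; case: (bit w p) => [-> //|_]; first by rewrite orbT eqxx.
by rewrite orbF; case: eqP => [->|]; rewrite ?ltnn ?andbF.
Qed.

Lemma code_inj w w' p : code w p = code w' p -> ltr w p = ltr w' p /\ red w p = red w' p.
Proof.
rewrite /code => e; have := ltn_ord (ltr w p); have := ltn_ord (ltr w' p) => l' l.
split; first by apply: val_inj => /=; move: e; case: (red w p); case: (red w' p) => /=; lia.
by move: e; case: (red w p); case: (red w' p) => //=; lia.
Qed.

Lemma code_ext w w' : valid w -> valid w' -> (forall p, code w p = code w' p) -> w = w'.
Proof.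
move=> vw vw' e; have el p := (code_inj (e p)).1; have er p := (code_inj (e p)).2.
by apply: bword_ext => // p; rewrite !bit_red // er !el.
Qed.

Lemma key_inj w w' : valid w -> valid w' -> key w = key w' -> w = w'.
Proof.
move=> vw vw' e.
have E p : key ((shift ^+ p)%g w) = key ((shift ^+ p)%g w').
  elim: p => [|p IH]; first by rewrite !expg0 !perm1.
  rewrite !expgSr !permM; apply/eqP; rewrite eqn_leq !key_shift_le ?IH ?leqnn //;
  apply/eqP; rewrite eqn_leq; apply/andP; split; apply: key_le_code; by rewrite IH.
apply: code_ext => // p; rewrite -[p]add0n -!code_shift.
by apply/eqP; rewrite eqn_leq !key_le_code ?E.
Qed.

Lemma red_ltr w p : valid w -> if red w p then ltr w p.+1 <= ltr w p else ltr w p <= ltr w p.+1.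
Proof.
move=> /validP/(_ p); rewrite /red; case: (bit w p) => [->//|_]; first by rewrite orbT leqnn.
by rewrite orbF; case: ltnP => // /ltnW.
Qed.

(** Codes weakly increase across a red letter and letters weakly increase across a blue one. A wrong
    comparison at a red start would propagate equality of codes and force all bits, which [word_set]
    excludes. At a blue start it would make the keys of the successive shifts increase forever,
    against periodicity. *)
Lemma key_red w : w \in word_set m T -> (key w < key (shift w)) = red w 0.
Proof.
rewrite inE => /andP[vw nb].
have codeS p : code w p.+1 = code ((shift ^+ p.+1)%g w) 0 by rewrite code_shift.
have code0 p : code w p = code ((shift ^+ p)%g w) 0 by rewrite code_shift.
have kS p : key ((shift ^+ p.+1)%g w) = key (shift ((shift ^+ p)%g w)) by rewrite expgSr permM.
case r0: (red w 0).
  rewrite ltnNge; apply: contraNN nb => le0; apply/all_bitsP.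
  have E p : [/\ red w p, ltr w p = ltr w 0 & key ((shift ^+ p.+1)%g w) <= key ((shift ^+ p)%g w)].
    elim: p => [|p [rp lp kp]]; first by rewrite expg0 perm1 expg1.
    have := red_ltr p vw; rewrite rp => le.
    have le2 : code w p.+1 <= code w p by rewrite codeS code0 key_le_code.
    have eqc : code w p.+1 = code w p.
      apply/eqP; rewrite eqn_leq le2 /= /code rp /=; lia.
    have [e1 e2] : ltr w p.+1 = ltr w p /\ red w p.+1 = red w p.
      by have := code_inj (w := (shift ^+ 1)%g w) (w' := w) (p := p); rewrite code_shift ltr_shift red_shift addn1; apply.
    split; [by rewrite e2 | by rewrite e1 |].
    by rewrite !kS key_shift_le -?kS // -codeS -code0.
  move=> p; have [rp lp _] := E p; have [_ lp1 _] := E p.+1.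
  by rewrite bit_red // rp lp lp1 eqxx.
apply/negP => lt0.
have E p : ~~ red w p /\ key ((shift ^+ p)%g w) < key ((shift ^+ p.+1)%g w).
  elim: p => [|p [rp kp]]; first by rewrite expg0 perm1 expg1 r0.
  have := red_ltr p vw; rewrite (negPf rp) => le.
  have le2 : code w p <= code w p.+1 by rewrite codeS code0 key_le_code // ltnW.
  have eqc : code w p.+1 = code w p.
    apply/eqP; rewrite eqn_leq le2 andbT /code rp /=; case: (red _ _) => /=; lia.
  have [e1 e2] : ltr w p.+1 = ltr w p /\ red w p.+1 = red w p.
    by have := code_inj (w := (shift ^+ 1)%g w) (w' := w) (p := p); rewrite code_shift ltr_shift red_shift addn1; apply.
  by rewrite e2; split=> //; rewrite !kS key_shift_lt -?kS // -codeS -code0.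
have : key w + T.+1 <= key ((shift ^+ T.+1)%g w).
  elim: (T.+1) => [|p IH]; first by rewrite expg0 perm1 addn0.
  by rewrite addnS (leq_ltn_trans IH) //; have [] := E p.
by rewrite shiftT perm1 leqNgt addnS ltnS leq_addr.
Qed.

End Keys.

(** * Words read along the cycles of a labelled permutation *)

Section StandardWords.

Variables (n m T : nat).
Hypothesis expT : forall s : 'S_n, (s ^+ T.+1 = 1)%g.
Local Notation word := (bword m T).
Local Notation shift := (shift m T).
Implicit Types (s : 'S_n) (f : {ffun 'I_n -> 'I_m}) (i j : 'I_n).

(* The infinite bicolored word read from position [i] along its cycle, cut at a common
   multiple of all periods. *)
Definition word_of s f i : word :=
  [ffun p : 'I_T.+1 => (f ((s ^+ p)%g i),
     excb s ((s ^+ p)%g i) && (f (s ((s ^+ p)%g i)) == f ((s ^+ p)%g i)))].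

Lemma perm_exp_modT s p i : (s ^+ (p %% T.+1))%g i = (s ^+ p)%g i.
Proof.
by rewrite [in RHS](divn_eq p T.+1) expgD mulnC expgM expT expg1n mul1g.
Qed.

Lemma ltr_word_of s f i p : ltr (word_of s f i) p = f ((s ^+ p)%g i).
Proof. by rewrite /ltr ffunE /= perm_exp_modT. Qed.

Lemma bit_word_of s f i p : bit (word_of s f i) p
  = excb s ((s ^+ p)%g i) && (f (s ((s ^+ p)%g i)) == f ((s ^+ p)%g i)).
Proof. by rewrite /bit ffunE /= perm_exp_modT. Qed.

Lemma shift_word_of s f i c : (shift ^+ c)%g (word_of s f i) = word_of s f ((s ^+ c)%g i).
Proof.
apply: bword_ext => p; rewrite ?ltr_shift ?bit_shift ?ltr_word_of ?bit_word_of;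
  by rewrite addnC expgD permM.
Qed.

Lemma valid_word_of s f i : valid (word_of s f i).
Proof.
apply/validP => p; rewrite bit_word_of !ltr_word_of => /andP[_ /eqP <-].
by rewrite expgSr permM.
Qed.

Section Standard.

Variables (s : 'S_n) (f : {ffun 'I_n -> 'I_m}).
Hypothesis std : standard s f.

Lemma standardE i j : i < j -> f j < f i \/ f j = f i /\ red_before s i j.
Proof.
move=> ij; have /'forall_forallP/(_ i j)/implyP/(_ ij) := std.
by case/orP => [|/andP[/eqP]]; [left | right].
Qed.

Lemma standard_le i j : i <= j -> f j <= f i.
Proof.
rewrite leq_eqVlt => /orP[/eqP/val_inj ->//|/standardE[/ltnW //|[-> _]]//].
Qed.

Lemma red_word_of i p : red (word_of s f i) p = excb s ((s ^+ p)%g i).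
Proof.
rewrite /red bit_word_of !ltr_word_of expgSr permM; set x := (s ^+ p)%g i.
case e: (excb s x) => /=; first by rewrite -val_eqE orbC -leq_eqVlt standard_le // ltnW.
by rewrite orbF; apply/negbTE; rewrite -leqNgt standard_le // leqNgt; apply/negbT.
Qed.

(** If all bits were set, every iterate of [i] under [s] would be an excedance and the iterates
    would increase forever. *)
Lemma word_of_in i : word_of s f i \in word_set m T.
Proof.
rewrite inE valid_word_of; apply/negP => /all_bitsP ab.
have E p : i + p <= (s ^+ p)%g i.
  elim: p => [|p IH]; first by rewrite expg0 perm1 addn0.
  have := ab p; rewrite bit_word_of => /andP[lt _].
  by rewrite addnS expgSr permM; apply: leq_ltn_trans lt.
by have := E n; have := ltn_ord ((s ^+ n)%g i); lia.
Qed.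

Lemma code_word_of i p : code (word_of s f i) p
  = 2 * (m - f ((s ^+ p)%g i)) + ~~ excb s ((s ^+ p)%g i).
Proof. by rewrite /code ltr_word_of red_word_of. Qed.

Lemma code_eq_step i j : i < j -> code (word_of s f i) 0 = code (word_of s f j) 0 -> s i < s j.
Proof.
move=> ij /code_inj[]; rewrite !ltr_word_of !red_word_of !expg0 !perm1 => ef ee.
have [|[_]] := standardE ij; first by rewrite ef ltnn.
by rewrite /red_before ee eqxx andbN.
Qed.

Lemma word_of_eq_lt i j : i < j -> word_of s f i = word_of s f j -> s i < s j.
Proof. by move=> ij e; apply: code_eq_step; rewrite // e. Qed.

Lemma code_word_of_le i j : i <= j -> code (word_of s f i) 0 <= code (word_of s f j) 0.
Proof.
rewrite leq_eqVlt => /orP[/eqP/val_inj ->//|ij].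
have := ltn_ord (f i); have := ltn_ord (f j).
rewrite !code_word_of !expg0 !perm1.
have [lt|[ef]] := standardE ij; first by case: (excb s i); case: (excb s j) => /=; lia.
by rewrite ef leq_add2l /red_before; case: (excb s i); case: (excb s j).
Qed.

(** If an earlier position had the larger word, the first codes would agree and the same situation
    would recur at the images; all codes would then agree and the words coincide. *)
Lemma key_word_of_le i j : i <= j -> key (word_of s f i) <= key (word_of s f j).
Proof.
rewrite leq_eqVlt => /orP[/eqP/val_inj ->//|ij]; rewrite leqNgt; apply/negP => lt.
pose W p k := word_of s f ((s ^+ p)%g k).
have WS p k : W p.+1 k = shift (W p k).
  by rewrite /W -[shift]expg1 shift_word_of expg1 expgSr permM.
have E p : [/\ (s ^+ p)%g i < (s ^+ p)%g j, key (W p j) < key (W p i)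
             & code (W p i) 0 = code (W p j) 0].
  elim: p => [|p [lp kp cp]].
    rewrite /W !expg0 !perm1; split=> //; apply/eqP.
    by rewrite eqn_leq code_word_of_le ?key_le_code // ltnW.
  have lS : (s ^+ p.+1)%g i < (s ^+ p.+1)%g j.
    by rewrite !expgSr !permM; apply: code_eq_step.
  have kS : key (W p.+1 j) < key (W p.+1 i) by rewrite !WS key_shift_lt.
  split=> //; apply/eqP; rewrite eqn_leq code_word_of_le ?key_le_code // ltnW //.
have eW : word_of s f i = word_of s f j.
  apply: code_ext; rewrite ?valid_word_of // => p.
  by rewrite -[p]add0n -!code_shift !shift_word_of; have [] := E p.
by rewrite eW ltnn in lt.
Qed.

(** [s] preserves the order of positions with equal words, so a nontrivial return to the same word
    would give a strictly monotone sequence of positions, against the finite order of [s]. Hence the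
    necklaces obtained are primitive. *)
Lemma word_of_perm_exp_inj c i : word_of s f ((s ^+ c)%g i) = word_of s f i -> (s ^+ c)%g i = i.
Proof.
move=> e; pose h t := (s ^+ (c * t))%g i.
have hS t : h t.+1 = (s ^+ (c * t))%g ((s ^+ c)%g i) by rewrite /h mulnS expgD permM.
have hT : h T.+1 = i by rewrite /h mulnC expgM expT expg1n perm1.
have h0 : h 0 = i by rewrite /h muln0 expg0 perm1.
have chain x y q : word_of s f x = word_of s f y -> x < y -> (s ^+ q)%g x < (s ^+ q)%g y.
  move=> exy xy; elim: q => [|q IH]; first by rewrite !expg0 !perm1.
  by rewrite !expgSr !permM word_of_eq_lt // -!shift_word_of exy.
case: (ltngtP ((s ^+ c)%g i) i) => [lt|lt|/val_inj //].
  have D t : h t + t <= h 0.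
    elim: t => [|t IH]; first by rewrite addn0.
    by apply: leq_trans IH; rewrite addnS ltn_add2r hS; apply: chain.
  by have := D T.+1; rewrite hT h0; lia.
have D t : h 0 + t <= h t.
  elim: t => [|t IH]; first by rewrite addn0.
  by rewrite addnS (leq_ltn_trans IH) // hS; apply: chain.
by have := D T.+1; rewrite hT h0; lia.
Qed.

Lemma period_word_of i : period (word_of s f i) = #|porbit s i|.
Proof.
have E c : (period (word_of s f i) %| c) = (#|porbit s i| %| c).
  rewrite -shift_period -perm_exp_fix shift_word_of.
  by apply/eqP/eqP => [/word_of_perm_exp_inj //|->].
by apply/eqP; rewrite eqn_dvd E dvdnn -E dvdnn.
Qed.

(** [s] carries each block of equal words to another one preserving the order, so the rank of a
    position within its block is kept. This rank is what determines [s] in [standard_unique]. *)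
Lemma card_word_of_lt i :
  #|[set y : 'I_n | (y < s i) && (word_of s f y == word_of s f (s i))]|
    = #|[set x : 'I_n | (x < i) && (word_of s f x == word_of s f i)]|.
Proof.
have wS x : word_of s f (s x) = shift (word_of s f x).
  by rewrite -[shift]expg1 shift_word_of expg1.
rewrite -(card_imset [set x : 'I_n | (x < i) && _] (@perm_inj _ s)).
apply: eq_card => y; rewrite inE; apply/idP/imsetP.
  move=> /andP[lt /eqP e]; exists ((s^-1)%g y); last by rewrite permKV.
  rewrite inE; have e2 : word_of s f ((s^-1)%g y) = word_of s f i.
    by apply: (@perm_inj _ shift); rewrite -!wS permKV.
  rewrite e2 eqxx andbT ltnNge; apply/negP; rewrite leq_eqVlt => /orP[/eqP/val_inj ei|].
    by move: lt; rewrite ei permKV ltnn.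
  by move=> /word_of_eq_lt-/(_ (esym e2)); rewrite permKV ltnNge ltnW.
case=> x; rewrite inE => /andP[lt /eqP e] ->.
by rewrite word_of_eq_lt //= !wS e.
Qed.

End Standard.

(** Sorting by [key] places every word at its position. The first letters then give [f], while the
    shifted word and the rank within its block give [s i]. *)
Lemma standard_unique s f s' f' : standard s f -> standard s' f' ->
  perm_eq [seq word_of s f i | i <- enum 'I_n] [seq word_of s' f' i | i <- enum 'I_n] ->
  s = s' /\ f = f'.
Proof.
move=> st st' pe.
have sorted_keys s1 f1 : standard s1 f1 ->
    sorted leq [seq key w | w <- [seq word_of s1 f1 i | i <- enum 'I_n]].
  move=> st1; rewrite -map_comp sorted_map.
  apply: (@sub_sorted _ (relpre val leq)) => [i j /=|]; first exact: key_word_of_le.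
  by rewrite -sorted_map val_enum_ord iota_sorted.
have ek : [seq key (word_of s f i) | i <- enum 'I_n]
        = [seq key (word_of s' f' i) | i <- enum 'I_n].
  rewrite (map_comp (@key m T) (word_of s f)) (map_comp (@key m T) (word_of s' f')).
  apply: (sorted_eq leq_trans anti_leq); rewrite ?sorted_keys //.
  exact: perm_map.
have ew i : word_of s f i = word_of s' f' i.
  apply: key_inj; rewrite ?valid_word_of //.
  by move/eq_in_map: ek => ek; apply: (ek i); rewrite mem_enum.
have ef : f = f'.
  apply/ffunP => i; have := congr1 (fun w => ltr w 0) (ew i).
  by rewrite !ltr_word_of !expg0 !perm1.
split=> //; apply/permP => i.
have eW : word_of s f (s i) = word_of s f (s' i).
  have := shift_word_of s f i 1; have := shift_word_of s' f' i 1.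
  by rewrite !expg1 -!ew => <- <-.
have c1 := card_word_of_lt st i; have c2 := card_word_of_lt st' i.
have c3 : #|[set y : 'I_n | (y < s i) && (word_of s f y == word_of s f (s i))]|
   = #|[set y : 'I_n | (y < s' i) && (word_of s f y == word_of s f (s i))]|.
  rewrite c1; transitivity #|[set x : 'I_n | (x < i) && (word_of s' f' x == word_of s' f' i)]|.
    by apply: eq_card => x; rewrite !inE !ew.
  by rewrite -c2; apply: eq_card => x; rewrite !inE -!ew -eW.
have strict a b (W : word) : word_of s f a = W -> a < b ->
   #|[set y : 'I_n | (y < a) && (word_of s f y == W)]|
     < #|[set y : 'I_n | (y < b) && (word_of s f y == W)]|.
  move=> ea ab; apply: proper_card; apply/properP; split.
    by apply/subsetP => y; rewrite !inE => /andP[/ltn_trans-/(_ _ ab) -> ->].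
  by exists a; rewrite !inE ?ltnn // ab ea eqxx.
case: (ltngtP (s i) (s' i)) => [lt|lt|/val_inj //].
  by have := strict _ _ _ (erefl _) lt; rewrite c3 ltnn.
by have := strict _ _ _ (esym eW) lt; rewrite c3 ltnn.
Qed.

End StandardWords.

Lemma lex_ltn n k k' a a' : a < n -> a' < n ->
  (k * n + a < k' * n + a') = (k < k') || ((k == k') && (a < a')).
Proof.
move=> lta lta'; case: (ltngtP k k') => [lt|lt|->] /=; last by rewrite ltn_add2l.
  by have := leq_mul lt (leqnn n); rewrite mulSn; lia.
by have := leq_mul lt (leqnn n); rewrite mulSn; lia.
Qed.

(** * Labelled permutations correspond to multisets of words *)

Section StandardMultisets.

Variables (n m T : nat).
Hypothesis expT : forall s : 'S_n, (s ^+ T.+1 = 1)%g.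
Local Notation word := (bword m T).
Local Notation shift := (shift m T).
Local Notation labelling := ('S_n * {ffun 'I_n -> 'I_m})%type.
Implicit Types (s : 'S_n) (f : {ffun 'I_n -> 'I_m}) (i j : 'I_n).

Definition word_multiset (u : labelling) : {ffun word -> 'I_n.+1} :=
  [ffun w => inord #|[set i | word_of T u.1 u.2 i == w]|].

Lemma word_multisetE u w : word_multiset u w = #|[set i | word_of T u.1 u.2 i == w]| :> nat.
Proof. by rewrite ffunE inordK // ltnS -[leqRHS]card_ord max_card. Qed.

Local Open Scope ring_scope.

Lemma sum_word_multiset (V : nmodType) (h : word -> V) u :
  \sum_w h w *+ word_multiset u w = \sum_i h (word_of T u.1 u.2 i).
Proof.
rewrite [RHS](partition_big (word_of T u.1 u.2) predT) //=; apply: eq_bigr => w _.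
rewrite (eq_bigr (fun=> h w)) => [|i /eqP -> //]; rewrite sumr_const word_multisetE.
by congr (_ *+ _); apply: eq_card => i; rewrite inE.
Qed.

Lemma prod_word_multiset (R : comPzRingType) (h : word -> R) u :
  \prod_w h w ^+ word_multiset u w = \prod_i h (word_of T u.1 u.2 i).
Proof.
rewrite [RHS](partition_big (word_of T u.1 u.2) predT) //=; apply: eq_bigr => w _.
rewrite (eq_bigr (fun=> h w)) => [|i /eqP -> //]; rewrite prodr_const word_multisetE.
by congr (_ ^+ _); apply: eq_card => i; rewrite inE.
Qed.

Definition perm_grade s : {poly int} := \sum_i ('X^#|porbit s i| + (excb s i : nat)%:R).

Lemma word_multiset_grade s f : standard s f ->
  \sum_w grade w *+ word_multiset (s, f) w = perm_grade s.
Proof.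
move=> st; rewrite sum_word_multiset; apply: eq_bigr => i _.
by rewrite /grade (period_word_of expT st) (red_word_of expT st) expg0 perm1.
Qed.

Lemma word_multiset_size u : (\sum_w word_multiset u w = n)%N.
Proof.
transitivity (\sum_w 1 *+ word_multiset u w : nat)%N.
  by apply: eq_bigr => w _; elim: (nat_of_ord _) => [//|k IH]; rewrite mulrS -IH.
by rewrite sum_word_multiset sum1_card card_ord.
Qed.

Lemma word_multiset_invariant s f : standard s f ->
  invariant_multiset (porbit shift) (word_set m T) (@grade m T) n (perm_grade s)
    (word_multiset (s, f)).
Proof.
move=> st; apply/invariant_multisetP; split.
- move=> x _ /porbitP[c ->]; apply: val_inj; rewrite /= !word_multisetE /=.
  rewrite -(card_imset [set i | _ == x] (@perm_inj _ (s ^+ c)%g)).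
  apply: eq_card => i; rewrite inE; apply/eqP/imsetP => [e|[k]].
    exists ((s ^+ c)^-1%g i); last by rewrite permKV.
    rewrite inE; apply/eqP; apply: (@perm_inj _ (shift ^+ c)%g).
    by rewrite (shift_word_of expT) permKV.
  by rewrite inE => /eqP <- ->; rewrite (shift_word_of expT).
- move=> x xW; rewrite word_multisetE; apply: eq_card0 => i; rewrite inE.
  by apply: contraNF xW => /eqP <-; apply: word_of_in.
- exact: word_multiset_size.
- exact: word_multiset_grade.
Qed.

Lemma count_word_multiset u (w : word) :
  count_mem w [seq word_of T u.1 u.2 i | i <- enum 'I_n] = word_multiset u w.
Proof.
rewrite word_multisetE -sum1_count big_map big_enum_cond /= -sum1_card.
by apply: eq_bigl => i; rewrite inE.
Qed.

Lemma word_multiset_inj s f s' f' : standard s f -> standard s' f' ->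
  word_multiset (s, f) = word_multiset (s', f') -> s = s' /\ f = f'.
Proof.
move=> st st' e; apply: (standard_unique expT st st').
apply/allP => w _ /=; apply/eqP.
by have := count_word_multiset (s, f) w; have := count_word_multiset (s', f') w; rewrite /= e => -> ->.
Qed.

Section Existence.

Variables (v : {poly int}) (N : {ffun word -> 'I_n.+1}).
Hypothesis Ninv : invariant_multiset (porbit shift) (word_set m T) (@grade m T) n v N.

(** Equal words are told apart by a copy number below their multiplicity. [phi] keeps this number,
    which is legitimate because multiplicities are shift invariant. *)
Let P : {set word * 'I_n} := [set u : word * 'I_n | (u.2 < N u.1)%N].
Let labelled_key (u : word * 'I_n) : nat := (key u.1 * n + u.2)%N.
Let phi (u : word * 'I_n) := (shift u.1, u.2).

Lemma multiset_shift w : N (shift w) = N w.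
Proof. by case/invariant_multisetP: Ninv => H _ _ _; apply: H; rewrite -[shift]expg1 mem_porbit. Qed.

Lemma multiset_le w : (N w <= n)%N.
Proof. by rewrite -ltnS ltn_ord. Qed.

Lemma card_labelled_fiber w : #|[set u in P | u.1 == w]| = N w.
Proof.
pose h (k : 'I_(N w)) := (w, widen_ord (multiset_le w) k).
have hinj : injective h by move=> k k' /(congr1 (fun u => val u.2)) e; apply: val_inj.
rewrite -[RHS]card_ord -(card_imset predT hinj).
apply: eq_card => [[w' k]]; rewrite !inE /=; apply/andP/imsetP => [[lt /eqP e]|[k' _ [-> ->]]] //=.
by rewrite e in lt *; exists (Ordinal lt) => //; rewrite /h; congr (_, _); apply: val_inj.
Qed.

Lemma card_labelled_words : #|P| = n.
Proof.
case/invariant_multisetP: Ninv => _ _ sN _; rewrite -[RHS]sN.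
rewrite -sum1_card (partition_big fst predT) //=; apply: eq_bigr => w _.
by rewrite -card_labelled_fiber -sum1_card; apply: eq_bigl => u; rewrite inE.
Qed.

Lemma labelled_word_in u : u \in P -> u.1 \in word_set m T.
Proof.
case/invariant_multisetP: Ninv => _ H _ _.
by rewrite inE; apply: contraTT => /H ->.
Qed.

Lemma shift_labelled_in u : (phi u \in P) = (u \in P).
Proof. by rewrite !inE /= multiset_shift. Qed.

Lemma shift_labelled_inj : injective phi.
Proof. by move=> [w a] [w' a'] [/perm_inj -> ->]. Qed.

Lemma labelled_key_lt u u' : (labelled_key u < labelled_key u')%N
  = ((key u.1 < key u'.1) || ((key u.1 == key u'.1) && (u.2 < u'.2)))%N.
Proof. exact: lex_ltn. Qed.

Lemma labelled_key_inj : {in P &, injective labelled_key}.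
Proof.
move=> u u' uP u'P e.
have := labelled_key_lt u u'; have := labelled_key_lt u' u; rewrite e ltnn.
case: (ltngtP (key u.1) (key u'.1)) => //= ek.
case: (ltngtP u.2 u'.2) => //= ea _ _.
have := labelled_word_in uP; have := labelled_word_in u'P; rewrite !inE => /andP[v' _] /andP[v1 _].
case: u u' ek ea v' v1 {e uP u'P} => [w a] [w' a'] /= ek ea v' v1.
by congr pair; [apply: key_inj | apply: val_inj].
Qed.

Lemma exists_enum : exists e : 'I_n -> word * 'I_n,
  [/\ forall i, e i \in P, forall u, u \in P -> exists i, e i = u
    & forall i j, (i < j)%N = (labelled_key (e i) < labelled_key (e j))%N].
Proof.
pose r := relpre labelled_key leq; pose lst := sort r (enum P).
have sz : size lst == n by rewrite size_sort -cardE card_labelled_words.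
have uq : uniq lst by rewrite sort_uniq enum_uniq.
have memP u : (u \in lst) = (u \in P) by rewrite mem_sort mem_enum.
have so : sorted r lst by apply: sort_sorted => u u'; apply: leq_total.
pose e i := tnth (Tuple sz) i.
have eP i : e i \in P by rewrite -memP mem_tnth.
have le i j : (i <= j)%N -> (labelled_key (e i) <= labelled_key (e j))%N.
  move=> ij; rewrite /e !(tnth_nth (e i)) /=.
  apply: (sorted_leq_nth (leT := r)) => //; rewrite ?inE ?(eqP sz) ?ltn_ord //.
    by move=> a b c; apply: leq_trans.
  by move=> a; apply: leqnn.
have einj : injective e.
  move=> i j; rewrite /e !(tnth_nth (e i)) /= => /eqP.
  by rewrite nth_uniq ?(eqP sz) ?ltn_ord // => /eqP/val_inj.
exists e; split=> // [u uP|i j].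
  have : u \in Tuple sz by rewrite memtE /= memP.
  by case/tnthP => i ->; exists i.
case: (ltnP i j) => ij; last by apply/esym/negbTE; rewrite -leqNgt le.
apply/esym; rewrite ltn_neqAle (le i j (ltnW ij)) andbT; apply: contraL ij => /eqP /labelled_key_inj e'.
by rewrite (einj _ _ (e' (eP i) (eP j))) ltnn.
Qed.

(** Positions are the ranks of the labelled words sorted by key and copy number; [s] is the shift
    transported to ranks, and [f] reads first letters. *)
Lemma exists_standard : exists s f, standard s f /\ word_multiset (s, f) = N.
Proof.
have [e [eP eS eK]] := exists_enum.
have einj : injective e.
  by move=> i j eij; case: (ltngtP i j) => [| |/val_inj //]; rewrite eK eij ltnn.
(* The default is never reached: [phi] preserves [P], and [e] enumerates all of [P]. *)
pose g i := odflt i [pick j | e j == phi (e i)].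
have gE i : e (g i) = phi (e i).
  rewrite /g; case: pickP => [j /eqP //|none].
  by have [j ej] := eS _ (etrans (shift_labelled_in (e i)) (eP i)); have := none j; rewrite ej eqxx.
have ginj : injective g by move=> i j eg; apply/einj/shift_labelled_inj; rewrite -!gE eg.
pose s := perm ginj; pose f := [ffun i => ltr (e i).1 0].
have sE i : e (s i) = phi (e i) by rewrite permE gE.
have seE p i : e ((s ^+ p)%g i) = ((shift ^+ p)%g (e i).1, (e i).2).
  elim: p => [|p IH]; first by rewrite !expg0 !perm1; case: (e i).
  by rewrite !expgSr !permM sE IH.
have eW i : (e i).1 \in word_set m T by apply: labelled_word_in.
have vE i : valid (e i).1 by have := eW i; rewrite inE => /andP[].
(* The copy number does not change under [phi], so comparing ranks is comparing a word with its
   shift, which [key_red] decides. *)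
have exE i : excb s i = red (e i).1 0.
  rewrite /excb eK sE labelled_key_lt /= ltnn andbF orbF; exact: key_red.
have wE i : word_of T s f i = (e i).1.
  apply: bword_ext => p.
    by rewrite (ltr_word_of expT) ffunE seE /= ltr_shift.
  rewrite (bit_word_of expT) exE !ffunE sE seE /= bit_red //.
  have -> : shift ((shift ^+ p)%g (e i).1) = (shift ^+ p.+1)%g (e i).1 by rewrite expgSr permM.
  by rewrite red_shift !ltr_shift !add0n.
exists s, f; split.
  apply/'forall_forallP => i j; apply/implyP => ij.
  have kij := ij; rewrite eK labelled_key_lt in kij.
  have kle : (key (e i).1 <= key (e j).1)%N by case/orP: kij => [/ltnW //|/andP[/eqP -> _]].
  have := key_le_code kle; rewrite leq_eqVlt => /orP[/eqP ec|].
    have [el er] := code_inj ec.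
    have ss : (s i < s j)%N.
      rewrite eK labelled_key_lt !sE /= key_shift_lt //.
      by rewrite !eqn_leq !key_shift_le // -eqn_leq.
    by rewrite !ffunE el eqxx /red_before !exE er eqxx ss !orbT.
  rewrite /code !ffunE /red_before !exE.
  have := ltn_ord (ltr (e i).1 0); have := ltn_ord (ltr (e j).1 0).
  rewrite -val_eqE /=; case: (red _ _); case: (red _ _) => /=; lia.
apply/ffunP => w; apply: val_inj; rewrite /= word_multisetE -card_labelled_fiber.
rewrite -(card_imset _ einj); apply: eq_card => u; rewrite inE; apply/imsetP/andP.
  by case=> i; rewrite inE wE => /eqP <- ->.
by case=> uP /eqP <-; have [i ei] := eS u uP; exists i; rewrite ?inE ?wE ?ei.
Qed.

End Existence.

(** [Q] is left free so that one bijection serves both the weighted sum and the count of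
    rotation-invariant multisets. *)
Lemma sum_standard_multiset (R : comPzRingType) (h : word -> R) (Q : pred {ffun word -> 'I_n.+1}) v :
  \sum_(u : labelling | [&& standard u.1 u.2, perm_grade u.1 == v & Q (word_multiset u)])
      \prod_i h (word_of T u.1 u.2 i)
    = \sum_(N | invariant_multiset (porbit shift) (word_set m T) (@grade m T) n v N && Q N)
        \prod_w h w ^+ N w.
Proof.
pose A := [set u : labelling | [&& standard u.1 u.2, perm_grade u.1 == v & Q (word_multiset u)]].
transitivity (\sum_(N in word_multiset @: A) \prod_w h w ^+ N w).
  rewrite big_imset /=; last first.
    move=> [s f] [s' f']; rewrite !inE => /and3P[st _ _] /and3P[st' _ _].
    by case/word_multiset_inj => // -> ->.
  by apply: eq_big => [u|u _]; rewrite ?inE // prod_word_multiset.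
apply: eq_bigl => N; apply/imsetP/andP => [[[s f]]|[iN QN]].
  by rewrite inE => /and3P[st /eqP <- Qu] ->; split=> //; apply: word_multiset_invariant.
have [s [f [st e]]] := exists_standard iN; exists (s, f) => //.
rewrite inE st e QN andbT /=.
by case/invariant_multisetP: iN => _ _ _ <-; rewrite -e word_multiset_grade.
Qed.

Variable M : nat.
Local Notation rot := (@wrot m T M).
Let rs : commute rot shift := @wrot_shift m T M.

Definition rot_invariant (u : labelling) : bool :=
  perm_eq [seq rot (word_of T u.1 u.2 i) | i <- enum 'I_n] [seq word_of T u.1 u.2 i | i <- enum 'I_n].

Lemma rot_invariantE u :
  rot_invariant u = [forall w, word_multiset u (rot w) == word_multiset u w].
Proof.
rewrite /rot_invariant map_comp; set l := [seq _ | i <- _].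
have cr w : count_mem (rot w) (map rot l) = count_mem w l.
  by rewrite count_map; apply: eq_count => x /=; rewrite (inj_eq perm_inj).
apply/idP/forallP => [pe w|H].
  rewrite -val_eqE /= -!count_word_multiset -/l; apply/eqP; rewrite -[RHS]cr.
  by move/seq.permP: pe => ->.
apply/allP => w _ /=; rewrite -[w](permKV rot) cr.
by have := H ((rot^-1)%g w); rewrite -val_eqE /= -!count_word_multiset eq_sym.
Qed.

Lemma invariant_orbit2E v (N : {ffun word -> 'I_n.+1}) :
  invariant_multiset (orbit2 shift rot) (word_set m T) (@grade m T) n v N
  = invariant_multiset (porbit shift) (word_set m T) (@grade m T) n v N
     && [forall w, N (rot w) == N w].
Proof.
apply/idP/andP => [/invariant_multisetP[H1 H2 H3 H4]|[/invariant_multisetP[H1 H2 H3 H4] /forallP Hr]].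
  split; last first.
    by apply/forallP => w; apply/eqP/H1/(orbit2P rs); exists 1%N; rewrite expg1.
  apply/invariant_multisetP; split=> // a b ba; apply: H1; apply/(orbit2P rs); exists 0%N.
  by rewrite expg0 perm1; apply/eqP; rewrite eq_porbit_mem.
apply/invariant_multisetP; split=> // a b /(orbit2P rs)[c /eqP].
rewrite eq_porbit_mem => /H1 ->.
by elim: c => [|c IH]; rewrite ?expg0 ?perm1 // expgSr permM (eqP (Hr _)).
Qed.

Theorem rotation_sieving (C : numFieldType) (d : nat) (w : C) v :
  d.-primitive_root w -> m = (d * M)%N ->
  \sum_(u : labelling | standard u.1 u.2 && (perm_grade u.1 == v)) w ^+ (\sum_i u.2 i)
    = #|[set u : labelling | [&& standard u.1 u.2, perm_grade u.1 == v & rot_invariant u]]|%:R.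
Proof.
move=> pw mE; have := multiset_sum_rotation T pw mE v (leqnn n).
rewrite /multiset_sum (eq_bigl _ _ (invariant_orbit2E v)).
rewrite -(sum_standard_multiset (fun=> 1) [pred N : {ffun word -> 'I_n.+1} | [forall w, N (rot w) == N w]] v).
have := sum_standard_multiset (fun x : word => w ^+ ltr x 0) predT v.
under [in X in _ = X -> _]eq_bigl do rewrite andbT.
move=> <- E.
transitivity (\sum_(u : labelling | [&& standard u.1 u.2, perm_grade u.1 == v & predT (word_multiset u)])
      \prod_i w ^+ ltr (word_of T u.1 u.2 i) 0).
  apply: eq_big => [u|u _]; first by rewrite andbT.
  by rewrite prodrXr; congr (_ ^+ _); apply: eq_bigr => i _; rewrite (ltr_word_of expT) expg0 perm1.
rewrite E -sum1_card natr_sum; apply: eq_big => [u|u _]; last by rewrite big1.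
by rewrite [RHS]inE rot_invariantE.
Qed.

End StandardMultisets.

(** * Restriction to full support *)

Section Relabelling.

Variables (d r : nat) (A : {set 'I_r}).
Local Notation q := #|A|.

Let e (k : nat) : nat := nth 0 [seq val x | x <- enum A] k.

Lemma relabel_sorted : sorted ltn [seq val x | x <- enum A].
Proof.
apply: (subseq_sorted ltn_trans _ (iota_ltn_sorted 0 r)).
by rewrite -val_enum_ord map_subseq // enumT filter_subseq.
Qed.

Lemma relabel_letter_lt k : k < q -> e k < r.
Proof.
move=> lk; have : e k \in [seq val x | x <- enum A] by rewrite mem_nth // size_map -cardE.
by case/mapP => x _ ->; apply: ltn_ord.
Qed.

Lemma relabel_letter_mono k l : k < q -> l < q -> (e k < e l) = (k < l).
Proof.
move=> lk ll; have sz : size [seq val x | x <- enum A] = q by rewrite size_map -cardE.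
have mono i j : i < q -> j < q -> i < j -> e i < e j.
  by move=> li lj; apply: (sorted_ltn_nth ltn_trans 0 relabel_sorted); rewrite inE sz.
case: (ltngtP k l) => [kl|lk'|->]; last by rewrite ltnn.
  exact: mono.
by apply/negbTE; rewrite -leqNgt ltnW // mono.
Qed.

Lemma relabel_card_gt0 (x : 'I_(d * q)) : 0 < q.
Proof. by have := leq_ltn_trans (leq0n x) (ltn_ord x); rewrite muln_gt0 => /andP[]. Qed.

Lemma relabel_block_lt (x : 'I_(d * q)) : x %/ q < d.
Proof. by rewrite ltn_divLR ?(relabel_card_gt0 x) // ltn_ord. Qed.

Lemma relabel_proof (x : 'I_(d * q)) : x %/ q * r + e (x %% q) < d * r.
Proof.
have lt := relabel_letter_lt (ltn_pmod x (relabel_card_gt0 x)).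
by apply: leq_trans (leq_mul (relabel_block_lt x) (leqnn r)); rewrite mulSn addnC ltn_add2r.
Qed.

(* The order isomorphism from [d * #|A|] letters to those whose residue modulo [r] is in [A];
   it intertwines the rotations by [#|A|] and by [r]. *)
Definition relabel x : 'I_(d * r) := Ordinal (relabel_proof x).

Lemma relabel_lt_mono x y : (relabel x < relabel y) = (x < y).
Proof.
rewrite /= lex_ltn ?relabel_letter_lt ?ltn_pmod ?(relabel_card_gt0 x) //.
have -> : (x < y) = (x %/ q * q + x %% q < y %/ q * q + y %% q) by rewrite -!divn_eq.
by rewrite lex_ltn ?ltn_pmod ?(relabel_card_gt0 x) // relabel_letter_mono ?ltn_pmod ?(relabel_card_gt0 x).
Qed.

Lemma relabel_inj : injective relabel.
Proof.
move=> x y exy; have := relabel_lt_mono x y; have := relabel_lt_mono y x.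
by rewrite exy ltnn; case: (ltngtP x y) => // /val_inj.
Qed.

Lemma modn_block k a s : a < s -> k < d -> (k * s + a + s) %% (d * s) = (k.+1 %% d) * s + a.
Proof.
move=> las; rewrite leq_eqVlt => /orP[/eqP <-|lt]; last first.
  rewrite (modn_small lt) addnAC -mulSnr modn_small //.
  by apply: leq_trans (leq_mul lt (leqnn s)); rewrite [X in _ <= X]mulSnr ltn_add2l.
by rewrite modnn mul0n add0n addnAC -mulSnr addnC modnDr modn_small // mulSn ltn_addr.
Qed.

Lemma relabel_rot x : relabel (rot_ltr q x) = rot_ltr r (relabel x).
Proof.
have q0 := relabel_card_gt0 x; have lx := ltn_pmod x q0.
apply: val_inj; rewrite /= !val_rot_ltr /=.
have -> : x + q = x %/ q * q + x %% q + q by rewrite -divn_eq.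
rewrite (modn_block (relabel_letter_lt lx) (relabel_block_lt x)) (modn_block lx (relabel_block_lt x)).
by rewrite divnMDl // (divn_small lx) addn0 modnMDl (modn_small lx).
Qed.

Hypothesis r0 : 0 < r.

Definition residue (b : 'I_(d * r)) : 'I_r := Ordinal (ltn_pmod b r0).

Lemma residue_relabel x : residue (relabel x) \in A.
Proof.
have lk := ltn_pmod x (relabel_card_gt0 x).
have : e (x %% q) \in [seq val x | x <- enum A] by rewrite mem_nth // size_map -cardE.
case/mapP => y; rewrite mem_enum => yA ey.
rewrite (_ : residue _ = y) //; apply: val_inj.
by rewrite /= modnMDl modn_small // relabel_letter_lt.
Qed.

Lemma relabel_surj b : residue b \in A -> exists x, relabel x = b.
Proof.
move=> bA; pose k := index (residue b) (enum A).
have lk : k < q by rewrite cardE index_mem mem_enum.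
have ek : e k = b %% r.
  rewrite /e (nth_map (residue b)) -?cardE // /k nth_index ?mem_enum //.
have lb : b %/ r < d by rewrite ltn_divLR.
have lx : b %/ r * q + k < d * q.
  by apply: leq_trans (leq_mul lb (leqnn q)); rewrite mulSn addnC ltn_add2r.
exists (Ordinal lx); apply: val_inj; rewrite /= divnMDl ?(leq_ltn_trans (leq0n k) lk) //.
by rewrite (divn_small lk) addn0 modnMDl (modn_small lk) ek -divn_eq.
Qed.

End Relabelling.

Section MapWord.

Variables (m m' T : nat) (phi : 'I_m -> 'I_m').
Hypothesis phi_inj : injective phi.

Definition map_word (w : bword m T) : bword m' T := [ffun p => (phi (w p).1, (w p).2)].

Lemma map_word_inj : injective map_word.
Proof.
move=> w w' /ffunP e; apply/ffunP => p; have := e p; rewrite !ffunE.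
by case: (w p) (w' p) => [? ?] [? ?] /= [/phi_inj -> ->].
Qed.

Variables (n : nat) (s : 'S_n) (f : {ffun 'I_n -> 'I_m}).

Lemma word_of_map i : word_of T s [ffun i => phi (f i)] i = map_word (word_of T s f i).
Proof. by apply/ffunP => p; rewrite !ffunE /= (inj_eq phi_inj). Qed.

Lemma rot_invariant_map q r : (forall x, phi (rot_ltr q x) = rot_ltr r (phi x)) ->
  rot_invariant T r (s, [ffun i => phi (f i)]) = rot_invariant T q (s, f).
Proof.
move=> phi_rot; rewrite /rot_invariant /=.
have eW : [seq word_of T s [ffun i => phi (f i)] i | i <- enum 'I_n]
   = map map_word [seq word_of T s f i | i <- enum 'I_n].
  by rewrite -map_comp; apply: eq_map => i; rewrite word_of_map.
have eR : [seq wrot m' T r (word_of T s [ffun i => phi (f i)] i) | i <- enum 'I_n]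
   = map map_word [seq wrot m T q (word_of T s f i) | i <- enum 'I_n].
  rewrite -map_comp; apply: eq_map => i /=; rewrite word_of_map !permE.
  by apply/ffunP => p; rewrite !ffunE /= phi_rot.
rewrite eW eR; apply/idP/idP; [exact: (perm_map_inj map_word_inj)|exact: perm_map].
Qed.

Lemma standard_map : (forall x y, (phi x < phi y) = (x < y)) ->
  standard s [ffun i => phi (f i)] = standard s f.
Proof.
move=> phi_lt; apply: eq_forallb => i; apply: eq_forallb => j.
by rewrite !ffunE phi_lt (inj_eq phi_inj).
Qed.

End MapWord.

(** * Full support and the centralizer *)

Section Centralizer.

Variables (d r T : nat).
Hypotheses (d0 : 0 < d) (r0 : 0 < r).
Local Notation n := (d * r).
Hypothesis expT : forall s : 'S_n, (s ^+ T.+1 = 1)%g.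
Implicit Types (s : 'S_n) (i j : 'I_n).

(** Alphabets of varying size become supports inside one alphabet of d r letters, the form that
    inclusion-exclusion over [A] requires. *)
Lemma card_relabel v (A : {set 'I_r}) :
  #|[set u : 'S_n * {ffun 'I_n -> 'I_(d * #|A|)} |
       [&& standard u.1 u.2, perm_grade u.1 == v & rot_invariant T #|A| u]]|
  = #|[set u : 'S_n * {ffun 'I_n -> 'I_n} |
       [&& standard u.1 u.2, perm_grade u.1 == v & rot_invariant T r u]
         && ([set residue r0 (u.2 i) | i : 'I_n] \subset A)]|.
Proof.
pose phi := @relabel d r A.
pose h (u : 'S_n * {ffun 'I_n -> 'I_(d * #|A|)}) := (u.1, [ffun i => phi (u.2 i)]).
have hinj : injective h.
  move=> [s f] [s' f'] [-> /ffunP e]; congr (_, _); apply/ffunP => i.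
  by have := e i; rewrite !ffunE => /relabel_inj.
have hP u : [&& standard (h u).1 (h u).2, perm_grade (h u).1 == v & rot_invariant T r (h u)]
   = [&& standard u.1 u.2, perm_grade u.1 == v & rot_invariant T #|A| u].
  case: u => s f; rewrite /= (standard_map (@relabel_inj d r A) s f (@relabel_lt_mono d r A)).
  by rewrite (rot_invariant_map T (@relabel_inj d r A) s f (@relabel_rot d r A)).
rewrite -(card_imset _ hinj); apply: eq_card => u; rewrite [RHS]inE.
apply/imsetP/andP => [[u']|[uP /subsetP sA]].
  rewrite inE -hP => u'P ->; split=> //; apply/subsetP => _ /imsetP[i _ ->].
  by rewrite ffunE residue_relabel.
have pre i : {x | phi x == u.2 i}.
  apply: sigW; have [|x <-] := @relabel_surj d r A r0 (u.2 i); last by exists x.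
  by apply: sA; apply: imset_f.
exists (u.1, [ffun i => sval (pre i)]); last first.
  rewrite /h /=; case: u uP sA pre => s f uP sA pre; congr (_, _).
  by apply/ffunP => i; rewrite !ffunE (eqP (svalP (pre i))).
rewrite inE -hP; congr (is_true _): uP; rewrite /h /=.
have -> : [ffun i => phi ([ffun i0 => sval (pre i0)] i)] = u.2.
  by apply/ffunP => i; rewrite !ffunE (eqP (svalP (pre i))).
by case: (u).
Qed.

Definition rev_labels : {ffun 'I_n -> 'I_n} := [ffun i => rev_ord i].

Lemma standard_rev s : standard s rev_labels.
Proof.
apply/'forall_forallP => i j; apply/implyP => ij; rewrite !ffunE /=.
by rewrite ltn_sub2l ?ltnS // (leq_ltn_trans ij).
Qed.

(** Rotation invariance closes the set of letters used under adding r, so meeting every residue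
    means using all letters. A weakly decreasing bijection is then the reversal. *)
Lemma full_support s (f : {ffun 'I_n -> 'I_n}) : standard s f -> rot_invariant T r (s, f) ->
  [set residue r0 (f i) | i : 'I_n] = setT -> f = rev_labels.
Proof.
move=> st ri full.
have rot i : exists j, f j = rot_ltr r (f i).
  have : wrot n T r (word_of T s f i) \in [seq wrot n T r (word_of T s f i) | i <- enum 'I_n].
    by apply: map_f; rewrite mem_enum.
  rewrite (perm_mem ri) => /mapP[j _ /= ej]; exists j; apply: val_inj.
  have := congr1 (fun w => nat_of_ord (ltr w 0)) ej.
  rewrite /= (ltr_word_of expT) expg0 perm1 => <-.
  by rewrite -[wrot _ _ _]expg1 ltr_wrot (ltr_word_of expT) expg0 perm1 mul1n val_rot_ltr.
have rotc c i : exists j, f j = (f i + c * r) %% n :> nat.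
  elim: c => [|c [j ej]]; first by exists i; rewrite addn0 modn_small.
  have [k ek] := rot j; exists k; rewrite ek val_rot_ltr ej modnDml mulSn.
  by rewrite -addnA [c * r + r]addnC.
have surj b : exists i, f i = b.
  have : residue r0 b \in setT by [].
  rewrite -full => /imsetP[i _ /(congr1 val) /= eb].
  (* One extra full turn keeps the number of rotations nonnegative: the letter reached is n + b
     modulo n. *)
  have [j ej] := rotc (b %/ r + (d - f i %/ r)) i; exists j; apply: val_inj; rewrite /= ej.
  have lf : f i %/ r < d by rewrite ltn_divLR.
  have -> : f i + (b %/ r + (d - f i %/ r)) * r = n + b.
    rewrite {1}(divn_eq (f i) r) -eb [in RHS](divn_eq b r).
    rewrite mulnDl mulnBl; have := leq_mul (ltnW lf) (leqnn r); lia.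
  by rewrite modnDl modn_small.
have finj : injective f.
  have /imset_injP : #|f @: 'I_n| == #|'I_n|.
    apply/eqP; apply: eq_card => b; rewrite inE; apply/imsetP.
    by have [i <-] := surj b; exists i.
  by move=> H i j; apply: H.
have dec k i j : j = i + k :> nat -> f j + k <= f i.
  elim: k i j => [|k IH] i j ej; first by rewrite addn0 in ej; rewrite (val_inj ej) addn0.
  have lj : j.-1 < n by apply: leq_ltn_trans (ltn_ord j); apply: leq_pred.
  have ek : j.-1 = i + k by rewrite ej addnS.
  have := IH i (Ordinal lj) ek.
  apply: leq_trans; rewrite addnS ltn_add2r ltn_neqAle.
  rewrite (standard_le st) ?andbT /=; last by rewrite leq_pred.
  by apply/eqP => /val_inj/finj/(congr1 val) /=; lia.
have n0 : 0 < n by rewrite muln_gt0 d0.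
have nn : n.-1 < n by rewrite ltn_predL.
apply/ffunP => i; rewrite ffunE; apply: val_inj => /=.
have top : n.-1 = i + (n.-1 - i) by have := ltn_ord i; lia.
(* The values drop by at least 1 at each position and must fit between n - 1 at the left end and 0
   at the right end, which leaves no slack. *)
have := dec i (Ordinal n0) i (erefl _); have := dec (n.-1 - i) i (Ordinal nn) top.
by have := ltn_ord (f (Ordinal n0)); lia.
Qed.

Lemma gamma_exp c i : (gamma n ^+ c)%g i = rot_ltr c i.
Proof. by rewrite permX; apply: eq_iter => j; rewrite permE. Qed.

Lemma ordS_rev i : ordS (rev_ord (ordS i)) = rev_ord i.
Proof.
apply: val_inj => /=; have := ltn_ord i; rewrite leq_eqVlt => /orP[/eqP e|lt].
  by rewrite e modnn subnn subn1 prednK ?modnn // (leq_ltn_trans (leq0n i)).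
rewrite (modn_small lt) modn_small; lia.
Qed.

Lemma rot_rev c i : rot_ltr c (rev_ord ((gamma n ^+ c)%g i)) = rev_ord i.
Proof.
rewrite gamma_exp; elim: c => [//|c IH].
by rewrite {1}/rot_ltr iterSr /= ordS_rev.
Qed.

(** The labels are distinct, so no bit is set and a word is just a trajectory of [s]. Since labels
    reverse positions, rotation can only match the word at [t x] with the word at [x]; comparing
    their second letters says that [s] commutes with [t]. *)
Lemma rot_invariant_rev s :
  rot_invariant T r (s, rev_labels) = (s \in 'C[gamma n ^+ r])%g.
Proof.
set t := (gamma n ^+ r)%g.
have ltr_rot i p : ltr (wrot n T r (word_of T s rev_labels i)) p
    = rot_ltr r (rev_ord ((s ^+ p)%g i)).
  apply: val_inj; rewrite -[wrot _ _ _]expg1 /= ltr_wrot (ltr_word_of expT) mul1n.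
  by rewrite val_rot_ltr ffunE.
apply/idP/cent1P => [ri|cs].
  apply/permP => x; rewrite !permM.
  have : wrot n T r (word_of T s rev_labels (t x)) \in
      [seq wrot n T r (word_of T s rev_labels i) | i <- enum 'I_n].
    by apply: map_f; rewrite mem_enum.
  rewrite (perm_mem ri) => /mapP[j _ /= ej].
  have e0 := congr1 (fun w => ltr w 0) ej; have e1 := congr1 (fun w => ltr w 1) ej.
  rewrite /= ltr_rot (ltr_word_of expT) ffunE !expg0 !perm1 rot_rev in e0.
  rewrite /= ltr_rot (ltr_word_of expT) ffunE !expg1 in e1.
  have ex : x = j := rev_ord_inj e0.
  have h : s (t x) = t (s x).
    apply: (@perm_inj _ t^-1%g); rewrite permK; apply: rev_ord_inj.
    by rewrite [in RHS]ex -e1 -[LHS](rot_rev r) permKV.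
  by rewrite h.
have wt x : wrot n T r (word_of T s rev_labels (t x)) = word_of T s rev_labels x.
  apply: bword_ext => p.
    rewrite ltr_rot (ltr_word_of expT) ffunE -permM.
    by rewrite (commuteX p (commute_sym cs)) permM rot_rev.
  rewrite -[wrot _ _ _]expg1 bit_wrot !(bit_word_of expT).
  have nb y : excb s y && (rev_labels (s y) == rev_labels y) = false.
    apply/negP => /andP[lt]; rewrite !ffunE (inj_eq rev_ord_inj) => /eqP e.
    by move: lt; rewrite /excb e ltnn.
  by rewrite !nb.
rewrite /rot_invariant /=.
have pt : perm_eq (map t (enum 'I_n)) (enum 'I_n).
  apply: uniq_perm; [by rewrite (map_inj_uniq (@perm_inj _ t)) enum_uniq | exact: enum_uniq |].
  move=> y; rewrite mem_enum; apply/mapP; by exists (t^-1 y)%g; rewrite ?permKV ?mem_enum.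
have ew : [seq word_of T s rev_labels i | i <- enum 'I_n]
    = map (fun i => wrot n T r (word_of T s rev_labels i)) (map t (enum 'I_n)).
  by rewrite -[RHS]map_comp; apply: eq_map => x /=; rewrite wt.
by rewrite ew perm_sym perm_map.
Qed.

Local Open Scope ring_scope.

Theorem sum_maj_exc (C : numFieldType) (w : C) v : d.-primitive_root w ->
  \sum_(s : 'S_n | perm_grade s == v) w ^+ (maj s - exc s)
    = #|[set s : 'S_n | (perm_grade s == v) && (s \in 'C[gamma n ^+ r])%g]|%:R.
Proof.
move=> pw.
have main (A : {set 'I_r}) := @rotation_sieving n (d * #|A|) T expT #|A| C d w v pw (erefl _).
transitivity (\sum_(A : {set 'I_r}) (-1) ^+ #|~: A| *
   \sum_(u : 'S_n * {ffun 'I_n -> 'I_(d * #|A|)} | standard u.1 u.2 && (perm_grade u.1 == v)) w ^+ (\sum_i u.2 i)).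
  transitivity (\sum_(A : {set 'I_r}) \sum_(s : 'S_n | perm_grade s == v)
    (-1) ^+ #|~: A| * \sum_(f : {ffun 'I_n -> 'I_(d * #|A|)} | standard s f) w ^+ (\sum_i f i)).
    rewrite exchange_big /=; apply: eq_bigr => s _.
    (* Here [c] is the same for all [A], so for each [s] the alternating sum of the binomial
       coefficients is 1. *)
    have [c H] := sum_standard s pw r0.
    under eq_bigr do rewrite H mulrCA.
    by rewrite -mulr_sumr alternating_sum_bin mulr1.
  apply: eq_bigr => A _; rewrite -mulr_sumr; congr (_ * _).
  by rewrite pair_big_dep /=; apply: eq_bigl => u; rewrite andbC.
pose P (u : 'S_n * {ffun 'I_n -> 'I_n}) :=
  [&& standard u.1 u.2, perm_grade u.1 == v & rot_invariant T r u].
pose R (u : 'S_n * {ffun 'I_n -> 'I_n}) := [set residue r0 (u.2 i) | i : 'I_n].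
transitivity (\sum_(A : {set 'I_r}) (-1) ^+ #|~: A| * \sum_(u | P u && (R u \subset A)) 1 : C).
  apply: eq_bigr => A _; congr (_ * _); rewrite main card_relabel -sum1_card natr_sum.
  by apply: eq_bigl => u; rewrite inE.
rewrite sum_sets_inclusion_exclusion sumr_const; congr _%:R.
pose h s := (s, rev_labels).
have hinj : injective h by move=> s s' [].
rewrite -(card_imset _ hinj); apply: eq_card => [[s f]].
apply/idP/imsetP => [/andP[/and3P[/= st gv ri] /eqP full]|[s' s'P [-> ->]]].
  have ef := full_support st ri full; rewrite ef in ri *.
  by exists s => //; rewrite inE gv -rot_invariant_rev.
move: s'P; rewrite inE => /andP[gv cs]; apply/andP; rewrite /P /= standard_rev gv rot_invariant_rev cs.
split=> //; apply/eqP/setP => b; rewrite inE; apply/imsetP.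
have lb : (b < n)%N by apply: leq_trans (ltn_ord b) _; rewrite leq_pmull.
exists (rev_ord (Ordinal lb)) => //=; apply: val_inj.
by rewrite ffunE rev_ordK /= modn_small.
Qed.

End Centralizer.

(** * Cycle type, excedances and the main theorem *)

Section GradeOfPerm.

Variable n : nat.
Implicit Types (s t : 'S_n) (i j : 'I_n).

Lemma excE s : exc s = \sum_i excb s i.
Proof.
rewrite /exc -sum1_card big_mkcond; apply: eq_bigr => i _; rewrite inE.
rewrite andb_idl => [|lt]; first by rewrite /excb; case: (i < s i).
exact: leq_ltn_trans lt (ltn_ord _).
Qed.

Definition cycle_lengths s : seq nat := [seq #|C| | C : {set 'I_n} <- enum (porbits s)].

Lemma card_porbit_length s k :
  #|[set i : 'I_n | #|porbit s i| == k]| = k * count_mem k (cycle_lengths s).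
Proof.
rewrite -sum1_card (partition_big (porbit s) (mem (porbits s))) /=; last first.
  by move=> i _; apply: imset_f.
transitivity (\sum_(C in porbits s | #|C| == k) k).
  rewrite [RHS]big_mkcondr /=; apply: eq_bigr => _ /imsetP[x _ ->].
  rewrite (eq_bigl (fun i => (#|porbit s x| == k) && (i \in porbit s x))) => [|i]; last first.
    by rewrite inE; case: eqVneq (eq_porbit_mem s i x) => [-> | _] <-; rewrite ?andbT ?andbF.
  case: eqP => [<-|_]; first by rewrite sum1_card.
  by rewrite big_pred0.
rewrite /cycle_lengths count_map -sum1_count big_enum_cond /= big_distrr /=.
by apply: eq_bigr => C _; rewrite muln1.
Qed.

Lemma cycle_lengths_gt0 s : 0 \notin cycle_lengths s.
Proof.
apply/mapP => [[C]]; rewrite mem_enum => /imsetP[x _ ->] /esym/eqP.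
by rewrite (negPf (card_porbit_neq0 s x)).
Qed.

Local Open Scope ring_scope.

Lemma coef_perm_grade s k :
  (perm_grade s)`_k = (if k is 0 then exc s else (k * count_mem k (cycle_lengths s))%N)%:R.
Proof.
rewrite /perm_grade coef_sum; under eq_bigr do rewrite coefD coefXn coefMn coef1.
case: k => [|k].
  rewrite excE natr_sum; apply: eq_bigr => i _.
  by rewrite eq_sym (negPf (card_porbit_neq0 s i)) add0r.
rewrite -card_porbit_length -sum1_card natr_sum [RHS]big_mkcond; apply: eq_bigr => i _.
by rewrite mul0rn addr0 inE eq_sym; case: eqP.
Qed.

(** For k > 0 the coefficient is k times the number of k-cycles, and k cancels. Degree 0 is free for
    the excedances because no cycle has length 0. *)
Lemma perm_grade_eq s t :
  (perm_grade s == perm_grade t) = (cycle_type s == cycle_type t) && (exc s == exc t).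
Proof.
have ct : (cycle_type s == cycle_type t) = perm_eq (cycle_lengths s) (cycle_lengths t).
  have tot : total geq by move=> a b; apply: leq_total.
  have tr : transitive geq by move=> a b c h1 h2; apply: leq_trans h2 h1.
  have anti : antisymmetric geq by move=> a b h; apply: anti_leq; rewrite andbC.
  exact/eqP/(perm_sortP tot tr anti).
apply/eqP/andP => [e|[e1 /eqP e2]].
  have ek k : (perm_grade s)`_k = (perm_grade t)`_k by rewrite e.
  split; last by have := ek 0%N; rewrite !coef_perm_grade => /eqP; rewrite eqr_nat.
  rewrite ct; apply/allP => k _ /=; case: k => [|k].
    by rewrite !(count_memPn _) ?cycle_lengths_gt0.
  have := ek k.+1; rewrite !coef_perm_grade => /eqP; rewrite eqr_nat => /eqP/eqP.
  by rewrite eqn_pmul2l.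
rewrite ct in e1; apply/polyP => [[|k]]; rewrite !coef_perm_grade ?e2 //.
by move/seq.permP: e1 => ->.
Qed.

Lemma card_porbit_conj s t i : #|porbit (s ^ t)%g (t i)| = #|porbit s i|.
Proof.
have E c : (#|porbit (s ^ t)%g (t i)| %| c)%N = (#|porbit s i| %| c)%N.
  by rewrite -!perm_exp_fix -conjXg permJ (inj_eq perm_inj).
by apply/eqP; rewrite eqn_dvd E dvdnn -E dvdnn.
Qed.

(** Comparisons change only by wrap-around: an excedance is gained at the index that wraps and lost
    where the image wraps. Each happens at exactly one index, and nothing changes if the two
    coincide. *)
Lemma exc_conj_gamma s : exc (s ^ gamma n)%g = exc s.
Proof.
rewrite !excE (reindex_inj (@perm_inj _ (gamma n))) /=.
pose last i := (i.+1 == n :> nat).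
have eL : (\sum_i last (s i) = \sum_i last i)%N by rewrite [RHS](reindex_inj (@perm_inj _ s)).
apply/eqP; rewrite -(eqn_add2r (\sum_i last i)) -{1}eL -!big_split /=; apply/eqP.
apply: eq_bigr => i _; rewrite /excb permJ !permE /last /=.
have := ltn_ord (s i); have := ltn_ord i.
rewrite (leq_eqVlt i.+1) (leq_eqVlt (s i).+1) => /orP[/eqP ei|li] /orP[/eqP ej|lj].
- by rewrite ei ej !modnn !eqxx; lia.
- by rewrite ei modnn (modn_small lj) eqxx; lia.
- by rewrite ej modnn (modn_small li) eqxx; lia.
by rewrite (modn_small li) (modn_small lj); lia.
Qed.

Lemma perm_grade_conj_gamma s : perm_grade (s ^ gamma n)%g = perm_grade s.
Proof.
rewrite /perm_grade !big_split /= -!natr_sum -!excE exc_conj_gamma; congr (_ + _).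
rewrite (reindex_inj (@perm_inj _ (gamma n))) /=.
by apply: eq_bigr => i _; rewrite card_porbit_conj.
Qed.

Lemma Sperm_conj lambda (k : nat) s t : t \in <[gamma n]>%g ->
  ((s ^ t)%g \in Sperm n lambda k) = (s \in Sperm n lambda k).
Proof.
case/cycleP => c ->; elim: c s => [|c IH] s; first by rewrite expg0 conjg1.
rewrite expgS conjgM IH !inE.
have /eqP := perm_grade_conj_gamma s; rewrite perm_grade_eq => /andP[/eqP -> /eqP ->].
by [].
Qed.

Hypothesis n0 : (0 < n)%N.

Lemma order_gamma : #[gamma n]%g = n.
Proof.
have val_gamma c (i : 'I_n) : ((gamma n ^+ c)%g i = (i + c) %% n :> nat)%N.
  by rewrite permX (eq_iter (permE _)) -/(rot_ltr c i) val_rot_ltr.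
apply/eqP; rewrite eqn_dvd order_dvdn; apply/andP; split.
  apply/eqP/permP => i; rewrite perm1; apply: val_inj.
  by rewrite /= val_gamma modnDr modn_small.
have := val_gamma #[gamma n]%g (Ordinal n0).
by rewrite expg_order perm1 /= add0n => /esym/eqP.
Qed.

End GradeOfPerm.

Local Open Scope ring_scope.

Lemma eval_apoly (K : comNzRingType) n lambda j (w : K) :
  eval_at (apoly n lambda j) w = \sum_(s in Sperm n lambda j) w ^+ (maj s - exc s).
Proof.
rewrite /eval_at /apoly rmorph_sum horner_sum; apply: eq_bigr => s _ /=.
by rewrite map_polyXn hornerXn.
Qed.

Lemma eval_apoly_cent (C : numFieldType) n lambda j (tau : 'S_n) (d : nat) (w : C) :
  (0 < n)%N -> tau \in <[gamma n]>%g -> #[tau]%g = d -> d.-primitive_root w ->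
  eval_at (apoly n lambda j) w = #|('C[tau])%g :&: Sperm n lambda j|%:R.
Proof.
move=> n0 tauG dE pw; rewrite eval_apoly.
(* A nonempty class is described by the grade of any of its members; for an empty one both sides
   vanish. *)
have [->|[s0 s0S]] := set_0Vmem (Sperm n lambda j).
  by rewrite big_set0 setI0 cards0.
have SE s : (s \in Sperm n lambda j) = (perm_grade s == perm_grade s0).
  rewrite perm_grade_eq; move: s0S; rewrite !inE => /andP[/eqP -> /eqP ->].
  by [].
have dn : (d %| n)%N by have := order_dvdG tauG; rewrite dE -orderE order_gamma.
have d0 := prim_order_gt0 pw.
(* A cyclic group has a single subgroup of each order, so [tau] and this power of [gamma] generate
   the same subgroup and have the same centralizer. *)
have cE : 'C[tau]%g = 'C[gamma n ^+ (n %/ d)]%g.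
  rewrite -!cent_cycle; congr ('C(_))%g; apply/eqP.
  rewrite (eq_subG_cyclic (cycle_cyclic (gamma n))) ?cycle_subG ?mem_cycle //.
  rewrite -!orderE dE orderXdiv ?order_gamma ?dvdn_div //.
  by rewrite divnA // mulKn.
rewrite cE (eq_bigl _ _ SE).
have [r nE] : exists r, n = (d * r)%N by exists (n %/ d)%N; rewrite mulnC divnK.
move: tau tauG dE cE s0 s0S SE; rewrite {}nE in n0 dn * => tau tauG dE cE s0 s0S SE.
have r0 : (0 < r)%N by move: n0; rewrite muln_gt0 => /andP[].
(* The word length is the order of the symmetric group, an exponent valid for all permutations at
   once. *)
have expT (s : 'S_(d * r)) : (s ^+ (((d * r)`!).-1.+1) = 1)%g.
  rewrite prednK ?fact_gt0 // -card_Sn -cardsT; apply: expg_cardG; exact: in_setT.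
rewrite mulKn // (sum_maj_exc d0 r0 expT (perm_grade s0) pw); congr _%:R.
by apply: eq_card => s; rewrite [RHS]inE andbC inE SE.
Qed.

Theorem theorem1p1 (R : realType) (n : nat) (hn : (1 <= n)%N)
    (lambda : seq nat) (hlambda : is_partition n lambda)
    (j : nat) (hj : (j < n)%N) :
  [/\ [acts <[gamma n]>%g, on Sperm n lambda j | 'J%act],
      cyclic_sieving R <[gamma n]>%G 'J%act (Sperm n lambda j)
        (apoly n lambda j)
    & forall (tau : 'S_n) (d : nat) (w : R[i]),
        tau \in <[gamma n]>%g -> #[tau]%g = d -> d.-primitive_root w ->
        eval_at (apoly n lambda j) w
          = #|('C[tau])%g :&: Sperm n lambda j|%:R].
Proof.
have acts : [acts <[gamma n]>%g, on Sperm n lambda j | 'J%act].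
  by apply/actsP => t tG s; rewrite -(Sperm_conj lambda j s tG).
split=> // [|tau d w tauG dE pw]; last exact: eval_apoly_cent pw.
split=> // [|g w gG pw]; first exact: cycle_cyclic.
rewrite (eval_apoly_cent lambda j hn gG (erefl _) pw) setIC; congr _%:R.
by rewrite afixJ cent_set1.
Qed.
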